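(* (a) For every integer $k \ge 6$, the class $\mathcal{G}_k$ consists exactly of the Cayley integral groups; that is, a finite group $G$ belongs to $\mathcal{G}_k$ if and only if $G$ is Cayley integral. (b) The classes $\mathcal{G}_4$ and $\mathcal{G}_5$ are equal, and they consist exactly of the following groups (up to isomorphism): (1) the Cayley integral groups; (2) the generalized dicyclic groups $Dic(E_{3^n} \times \mathbb{Z}_6)$, where $n \ge 1$.
   Context: All groups are finite. For a finite group $G$ and a subset $S \subseteq G$ with $1 \notin S$ and $S = S^{-1} = \{s^{-1} : s \in S\}$, the Cayley graph $\mathrm{Cay}(G,S)$ is the simple undirected graph with vertex set $G$ and edges $\{g, sg\}$ for $g \in G$, $s \in S$. A finite simple graph is integral if all eigenvalues of its adjacency matrix are integers. A finite group $G$ is called Cayley integral if $\mathrm{Cay}(G,S)$ is integral for all subsets $S \subseteq G$ with $1 \notin S = S^{-1}$. For a positive integer $k$, $\mathcal{G}_k$ is the class of all finite groups $G$ such that $\mathrm{Cay}(G,S)$ is integral for every $S \subseteq G$ with $1 \notin S = S^{-1}$ and $|S| \le k$. $\mathbb{Z}_n$ is the cyclic group of order $n$, and $E_n$ (for $n$ a prime power) is the elementary abelian group of order $n$. If $A$ is an abelian group with a unique involution $t$ and $|A| > 2$, the generalized dicyclic group is $Dic(A) = \langle A, x \rangle$ (of order $2|A|$), where $x^2 = t$ and $x^{-1} a x = a^{-1}$ for every $a \in A$. *)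

(* Defs.v *)
From HB Require Import structures.
From mathcomp Require Import all_boot all_order all_algebra all_fingroup.
From mathcomp Require Import all_solvable all_field.

Set Implicit Arguments.
Unset Strict Implicit.
Unset Printing Implicit Defensive.

Import GroupScope.

Definition adjacency_mx (T : finType) (V : {set T}) (e : rel T) :
    'M[algC]_#|V| :=
  \matrix_(i, j) ((e (enum_val i) (enum_val j))%:R)%R.

(* The adjacency matrix has integer entries, so its complex eigenvalues are
   algebraic numbers: taking them in algC loses none of them. *)
Definition integral_graph (T : finType) (V : {set T}) (e : rel T) : Prop :=
  forall a : algC, eigenvalue (adjacency_mx V e) a -> a \is a Num.int.

(* g and h are joined when h = s * g for some s in S. *)
Definition cayley_edge (gT : finGroupType) (S : {set gT}) : rel gT :=
  fun g h => h * g^-1 \in S.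

Lemma cayley_edge_irr (gT : finGroupType) (S : {set gT}) :
  1 \notin S -> irreflexive (cayley_edge S).
Proof. by move=> S1 g; rewrite /cayley_edge mulgV (negbTE S1). Qed.

Lemma cayley_edge_sym (gT : finGroupType) (S : {set gT}) :
  S^-1 = S -> symmetric (cayley_edge S).
Proof. by move=> SV g h; rewrite /cayley_edge -{1}SV inE invMg invgK. Qed.

Definition connection_set (gT : finGroupType) (G S : {set gT}) : Prop :=
  [/\ S \subset G, 1 \notin S & S^-1 = S].

Definition Cayley_integral (gT : finGroupType) (G : {group gT}) : Prop :=
  forall S : {set gT}, connection_set G S -> integral_graph G (cayley_edge S).

Definition in_class (k : nat) (gT : finGroupType) (G : {group gT}) : Prop :=
  forall S : {set gT}, connection_set G S -> #|S| <= k ->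
    integral_graph G (cayley_edge S).

(* G is Dic(A), with A identified with its copy inside G. The condition on #|G|
   excludes the case x \in A. *)
Definition gen_dicyclic (gT : finGroupType) (A G : {group gT}) : Prop :=
  [/\ abelian A, 2 < #|A|, #|G| = (2 * #|A|)%N &
    exists t x : gT,
      [/\ [set a in A | #[a] == 2] = [set t],
          A <*> <[x]> = G,
          x ^+ 2 = t &
          forall a, a \in A -> a ^ x = a^-1]].

Definition is_E3n_Z6 (gT : finGroupType) (n : nat) (A : {group gT}) : Prop :=
  exists E C : {group gT},
    [/\ 3.-abelem E, #|E| = (3 ^ n)%N, cyclic C, #|C| = 6 & E \x C = A].

(* Main.v *)
Require Import Defs.
From HB Require Import structures.
From mathcomp Require Import all_boot all_order all_algebra all_fingroup.
From mathcomp Require Import all_solvable all_field.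
From mathcomp Require Import zify ring.

(* Left multiplication by g on G defines a matrix, and the adjacency matrix of
   Cay(G, S) is the sum T of the matrices of the elements of S. If some V <> 0
   with integer coefficients in the group algebra satisfies V T^2 = b V T + c V,
   where X^2 - b X - c has no integer root, then Cay(G, S) is not integral. Such
   V are projections to a small representation in which T^2 - b T - c vanishes.

   For G in class 4, sets S of at most four elements and this obstruction show
   that every element satisfies s^4 = 1 or s^6 = 1, that in a 2-subgroup x^y is x
   or x^-1, that the Sylow 3-subgroup P is elementary abelian, and that each
   2-element inverts or centralizes each element of order 3, elements of order 4
   always inverting. Hence P is normal, a Sylow 2-subgroup Q acts on P by signs,
   and either all pairs {s, s^-1} are invariant under conjugation, or G = P <x>
   with x inverting P and x^4 = 1, where moreover |P| = 3 when x^2 = 1.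

   In the first case the sums s + s^-1 are central with integer eigenvalues. In
   the second case the part of S inside the abelian subgroup P <x^2> is handled
   likewise, and the rest of S is a union of cosets of <x^2>; up to two of them,
   or three filling a coset of <p, x^2>, have commuting sums with integer
   eigenvalues. If |P| > 3, three such cosets (six elements of S) already
   produce the eigenvalue 2 sqrt 3. *)

Set Implicit Arguments.
Unset Strict Implicit.
Unset Printing Implicit Defensive.

Import Order.TTheory GRing.Theory Num.Theory GroupScope.

(** * Regular matrices and integer spectra *)

(* [mxE] would also unfold products; these expose only linear structure. *)
Lemma mx_linE (R : pzRingType) m n :
  ((forall (A B : 'M[R]_(m, n)) i j, ((A + B) i j = A i j + B i j)%R)
  * (forall (A : 'M[R]_(m, n)) i j, ((- A) i j = - A i j)%R)
  * (forall a (A : 'M[R]_(m, n)) i j, ((a *: A) i j = a * A i j)%R)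
  * (forall i j, ((0 : 'M[R]_(m, n)) i j = 0)%R))%type.
Proof. by do !split=> *; rewrite mxE. Qed.

Ltac mx_linear :=
  apply/matrixP=> ? ?; rewrite ?mulr2n !mx_linE; ring.

Lemma scaler_mulmx (R : pzRingType) n a (A B : 'M[R]_n) :
  ((a *: A) * B = a *: (A * B))%R.
Proof. by rewrite -[LHS]scalemxAl. Qed.

Section RegularMatrices.

Variables (gT : finGroupType) (G : {group gT}).
Implicit Types (g h x : gT) (S : {set gT}) (l : seq gT).

(** Row vectors are multiplied from the right: the basis vector of [y] goes to that of [g^-1 * y].
    The inverse makes [regmx] multiplicative. *)
Definition regmx (g : gT) : 'M[algC]_#|G| :=
  \matrix_(i, j) ((enum_val j == g^-1 * enum_val i)%g%:R)%R.

Definition setmx (S : {set gT}) : 'M[algC]_#|G| := (\sum_(g in S) regmx g)%R.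

Lemma regmxM g h : g \in G -> regmx (g * h) = (regmx g * regmx h)%R.
Proof.
move=> Gg; apply/matrixP=> i j; rewrite !mxE.
have Gi : g^-1 * enum_val i \in G by rewrite groupM ?groupV ?enum_valP.
rewrite (bigD1 (enum_rank_in Gi (g^-1 * enum_val i))) //= big1 => [|k ne_k].
  by rewrite !mxE enum_rankK_in // eqxx GRing.mul1r GRing.addr0 invMg mulgA.
rewrite !mxE (_ : _ == _ = false) ?GRing.mul0r //.
by apply: contraNF ne_k => Ek; rewrite -(inj_eq enum_val_inj) enum_rankK_in.
Qed.

Lemma regmx1 : regmx 1 = 1%R.
Proof.
by apply/matrixP=> i j; rewrite !mxE invg1 mul1g (inj_eq enum_val_inj) eq_sym.
Qed.

Lemma mxtrace_regmx g : (\tr (regmx g) = (g == 1)%g%:R *+ #|G|)%R.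
Proof.
rewrite /mxtrace (eq_bigr (fun=> (g == 1)%g%:R%R)) => [|i _].
  by rewrite GRing.sumr_const card_ord.
by rewrite mxE -{1}[enum_val i]mul1g (inj_eq (mulIg _)) eq_sym eq_invg1.
Qed.

Lemma adjacency_setmx S : S \subset G -> S^-1 = S ->
  adjacency_mx G (cayley_edge S) = setmx S.
Proof.
move=> sSG SV; apply/matrixP=> i j; rewrite mxE summxE /cayley_edge.
have [Ss | nSs] := boolP (_ \in S).
  (* Only this element contributes to the entry; the edge relation provides its inverse, so closure
     under inverses enters here. *)
  rewrite (bigD1 (enum_val i * (enum_val j)^-1)) /=; last first.
    by rewrite -SV inE invMg invgK.
  rewrite mxE invMg invgK mulgKV eqxx big1 ?GRing.addr0 // => s /andP[_ ne_s].
  rewrite mxE (_ : _ == _ = false) //; apply: contraNF ne_s => /eqP->.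
  by rewrite invMg invgK mulKVg.
rewrite big1 // => s Ss; rewrite mxE (_ : _ == _ = false) //.
by apply: contraNF nSs => /eqP->; rewrite mulgK -SV inE invgK.
Qed.

Lemma setmx_seq (l : seq gT) : uniq l ->
  setmx [set x in l] = (\sum_(x <- l) regmx x)%R.
Proof. by move=> ul; rewrite /setmx big_uniq //=; apply: eq_bigl => x; rewrite inE. Qed.

End RegularMatrices.

(** * Common eigenvectors and integer spectra *)

Section Eigenvalues.

Local Open Scope ring_scope.

Variable n : nat.
Implicit Types A B T V : 'M[algC]_n.

(** [A] preserves the eigenspace of [T], and its restriction to this nonzero space has an
    eigenvector because [algC] is algebraically closed. *)
Lemma comm_eigenvector T A a : (T * A = A * T)%R -> eigenvalue T a ->
  exists2 v : 'rV_n, v != 0%R & v *m T = (a *: v)%R /\ exists b, v *m A = (b *: v)%R.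
Proof.
move=> cTA eTa.
have st : stablemx (eigenspace T a) A by rewrite comm_mx_stable_eigenspace.
have [|b] := @eigenvalue_closed _ _ (restrictmx (eigenspace T a) A).
  by rewrite lt0n mxrank_eq0.
case/eigenvalueP=> v vAb vN0.
exists (v *m row_base (eigenspace T a)); first by rewrite mulmx_free_eq0 ?row_base_free.
split; first by apply/eigenspaceP; rewrite mulmx_sub // eq_row_base.
apply/sub_rVP; rewrite -[X in is_true X]stablemx_restrict //.
by rewrite vAb scalemx_sub.
Qed.

Definition int_spectrum A : Prop := forall a, eigenvalue A a -> a \is a Num.int.

Lemma int_spectrum0 : int_spectrum 0%R.
Proof.
move=> a /eigenvalueP[v]; rewrite mulmx0 => /esym/eqP.
by rewrite scaler_eq0 => /orP[/eqP-> | /eqP->]; rewrite ?eqxx ?rpred0.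
Qed.

(** An eigenvector of the sum can be chosen to be one of [A], hence of [B]; its eigenvalue is then a
    sum of two integers. *)
Lemma int_spectrumD A B : (A * B = B * A)%R ->
  int_spectrum A -> int_spectrum B -> int_spectrum (A + B)%R.
Proof.
move=> cAB iA iB a /(@comm_eigenvector _ A)[|v vN0 [vT [b vA]]].
  by rewrite GRing.mulrDl GRing.mulrDr cAB.
have vB : v *m B = ((a - b) *: v)%R.
  by rewrite scalerBl -vT -vA mulmxDr GRing.addrC addKr.
rewrite -[a](subrK b) rpredD //.
  by apply: iB; apply/eigenvalueP; exists v.
by apply: iA; apply/eigenvalueP; exists v.
Qed.

Lemma int_spectrumN A : int_spectrum A -> int_spectrum (- A)%R.
Proof.
move=> iA a /eigenvalueP[v vA vN0]; rewrite -rpredN; apply: iA.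
by apply/eigenvalueP; exists v => //; rewrite scaleNr -vA mulmxN opprK.
Qed.

Lemma int_spectrumB A B : (A * B = B * A)%R ->
  int_spectrum A -> int_spectrum B -> int_spectrum (A - B)%R.
Proof.
by move=> cAB iA /int_spectrumN iB; apply: int_spectrumD => //;
  rewrite GRing.mulrN GRing.mulNr cAB.
Qed.

(* The rows of [V] span a [T]-stable space on which [T] is a root of
   [X^2 - bX - c]. *)
Lemma quadratic_int_root T V (b c : int) : int_spectrum T -> V != 0%R ->
  (V * T * T = b%:~R *: (V * T) + c%:~R *: V)%R ->
  exists r : int, (r * r = b * r + c)%R.
Proof.
move=> iT VN0 VTT.
have [i rVN0] : exists i, row i V != 0%R.
  apply/existsP; apply: contraNT VN0; rewrite negb_exists => /forallP V0.
  by apply/eqP/row_matrixP=> i; rewrite row0; apply/eqP; have := V0 i; rewrite negbK.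
set v := row i V in rVN0.
have vTT : (v *m T *m T = b%:~R *: (v *m T) + c%:~R *: v)%R.
  by rewrite -!row_mul [_ *m T]VTT linearP linearZ /=.
have [r [s [Drs Prs]]] : exists r s : algC, (r + s = b%:~R /\ r * s = - c%:~R)%R.
  pose d : algC := sqrtC (b%:~R ^+ 2 + c%:~R *+ 4)%R.
  have d2 : (d ^+ 2 = b%:~R ^+ 2 + c%:~R *+ 4)%R by rewrite sqrtCK.
  exists ((b%:~R + d) / 2%:R)%R, ((b%:~R - d) / 2%:R)%R; split; first by field.
  suff -> : (c%:~R = (d ^+ 2 - b%:~R ^+ 2) / 4%:R)%R by field.
  by rewrite d2; field.
have Ec : (c%:~R = - (r * s))%R by rewrite Prs opprK.
have root_r (x : algC) : (x * x = b%:~R * x + c%:~R)%R -> x \is a Num.int ->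
    exists y : int, (y * y = b * y + c)%R.
  move=> Ex /intrP[y Dy]; exists y; apply/eqP; rewrite -(eqr_int algC).
  by rewrite !(rmorphD, rmorphM) /= -Dy Ex.
(* Either [v T = r v] and [r] is an eigenvalue, or [v T - r v] is a nonzero eigenvector for the
   other root [s]. *)
have [w0 | wN0] := eqVneq (v *m T - r *: v)%R 0%R.
  apply: (root_r r); last first.
    by apply/iT/eigenvalueP; exists v => //; apply/eqP; rewrite -subr_eq0 w0.
  by rewrite -Drs Ec; ring.
apply: (root_r s).
  by rewrite -Drs Ec; ring.
apply/iT/eigenvalueP; exists (v *m T - r *: v)%R => //.
rewrite mulmxBl vTT -scalemxAl -Drs Ec.
by mx_linear.
Qed.

End Eigenvalues.

(** * Connection sets given by lists, and traces of roots of unity *)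

Lemma in_class_leq k m (gT : finGroupType) (G : {group gT}) :
  k <= m -> in_class m G -> in_class k G.
Proof. by move=> km Gm S cS Sk; apply: Gm => //; apply: leq_trans km. Qed.

Lemma invmem_set (gT : finGroupType) (l : seq gT) :
  all (fun x => x^-1 \in l) l -> [set x in l]^-1 = [set x in l].
Proof.
move=> /allP lV; apply/setP=> x; rewrite !inE; apply/idP/idP => [/lV | /lV] //.
by rewrite invgK.
Qed.

Lemma in_class_spectrum k (gT : finGroupType) (G : {group gT}) (l : seq gT) :
    in_class k G -> size l <= k -> uniq l -> all (mem G) l -> 1 \notin l ->
    all (fun x => x^-1 \in l) l ->
  int_spectrum (\sum_(x <- l) regmx G x)%R.
Proof.
move=> Gk lk ul /allP lG l1 lV.
have sSG : [set x in l] \subset G by apply/subsetP=> x; rewrite inE => /lG.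
have SV := invmem_set lV.
rewrite -setmx_seq // -adjacency_setmx //; apply: Gk; first by split; rewrite ?inE.
by rewrite (leq_trans _ lk) // cardsE card_size.
Qed.

Lemma left_eigenvalue n (V T : 'M[algC]_n) a :
  V != 0%R -> (V * T = a *: V)%R -> eigenvalue T a.
Proof.
move=> VN0 VT; have [i rN0] : exists i, row i V != 0%R.
  apply/existsP; apply: contraNT VN0; rewrite negb_exists => /forallP V0.
  by apply/eqP/row_matrixP=> i; rewrite row0; apply/eqP; have := V0 i; rewrite negbK.
by apply/eigenvalueP; exists (row i V) => //; rewrite -row_mul [(_ *m T)%R]VT linearZ.
Qed.

Lemma mxtrace_neq0 n (V : 'M[algC]_n) : (\tr V != 0)%R -> V != 0%R.
Proof. by apply: contraNneq => ->; rewrite mxtrace0. Qed.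

(** The integer [r = w + w^-1] has [|r| <= 2] because [|w| = 1], and [w^2 = r w - 1] settles the
    five values: [r = -2, 2] give [w = -1, 1], while [r = -1, 1] give [w^3 = 1, -1] and [r = 0]
    gives [w^2 = -1]. *)
Lemma unity_root_trace_int (w : algC) (n : nat) : (n.-primitive_root w)%R ->
  (w + w^-1)%R \is a Num.int -> n %| 4 \/ n %| 6.
Proof.
move=> pw /intrP[r Er]; have n0 := prim_order_gt0 pw.
have nw : (`|w| = 1)%R.
  apply/eqP; rewrite -(@pexpr_eq1 _ _ n) ?normr_ge0 -?lt0n //.
  by rewrite -normrX (prim_expr_order pw) normr1.
have w0 : w != 0%R by rewrite -normr_eq0 nw oner_eq0.
have r2 : (`|r| <= 2)%R.
  rewrite -(ler_int algC) intr_norm -Er (le_trans (ler_normD _ _)) //.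
  by rewrite normfV nw invr1.
have Ew : (w ^+ 2 = r%:~R * w - 1)%R.
  by rewrite -Er mulrDl mulVf // addrK.
rewrite !(prim_order_dvd pw).
have : (r \in [:: -2; -1; 0; 1; 2])%R by rewrite !inE; lia.
rewrite !inE => /or4P[|||/orP[]] /eqP Dr; rewrite {}Dr in Ew.
- left; apply/eqP; have /eqP : ((w + 1) ^+ 2 = 0)%R by rewrite sqrrD Ew; ring.
  by rewrite expf_eq0 /= addr_eq0 => /eqP->; ring.
- right; apply/eqP; transitivity ((w ^+ 2 * w) ^+ 2)%R; first by ring.
  by rewrite Ew mulrBl -mulrA -expr2 Ew; ring.
- by left; apply/eqP; rewrite (exprM _ 2 2) Ew; ring.
- right; apply/eqP; transitivity ((w ^+ 2 * w) ^+ 2)%R; first by ring.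
  by rewrite Ew mulrBl -mulrA -expr2 Ew; ring.
- left; apply/eqP; have /eqP : ((w - 1) ^+ 2 = 0)%R by rewrite sqrrB Ew; ring.
  by rewrite expf_eq0 /= subr_eq0 => /eqP->; ring.
Qed.

Lemma expg2E (gT : finGroupType) (s : gT) : s ^+ 2 = s * s.
Proof. by []. Qed.

Lemma expg3E (gT : finGroupType) (s : gT) : s ^+ 3 = s * s * s.
Proof. by rewrite expgSr. Qed.

Lemma invg_expg2 (gT : finGroupType) (s : gT) : s ^+ 2 = 1 -> s^-1 = s.
Proof. by move=> s2; apply/eqP; rewrite eq_invg_mul; apply/eqP. Qed.

Lemma invg_expg3 (gT : finGroupType) (s : gT) : s ^+ 3 = 1 -> s * s = s^-1.
Proof. by move=> s3; apply/eqP; rewrite eq_sym eq_invg_mul mulgA -expg3E s3. Qed.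

Lemma invg_expg4 (gT : finGroupType) (s : gT) : s ^+ 4 = 1 -> s^-1 = s * s * s.
Proof. by move=> s4; apply/eqP; rewrite eq_invg_mul !mulgA -s4 !expgSr expg0 mul1g. Qed.

Definition no_int_root (b c : int) : Prop := forall r : int, (r * r = b * r + c)%R -> False.

(** For the small coefficients below, [r * r] exceeds [b * r + c] once [|r| >= 4], which leaves
    seven values to substitute. *)
Ltac no_int_root_tac :=
  intros r Er;
  assert (Dr : ((r <= -4) \/ r = -3 \/ r = -2 \/ r = -1 \/ r = 0 \/
    r = 1 \/ r = 2 \/ r = 3 \/ 4 <= r)%R) by lia;
  repeat (destruct Dr as [Dr | Dr]; [try subst r; nia |]); nia.

Lemma no_int_root_2 : no_int_root 0 2. Proof. no_int_root_tac. Qed.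
Lemma no_int_root_3 : no_int_root 0 3. Proof. no_int_root_tac. Qed.
Lemma no_int_root_5 : no_int_root 0 5. Proof. no_int_root_tac. Qed.
Lemma no_int_root_8 : no_int_root 0 8. Proof. no_int_root_tac. Qed.
Lemma no_int_root_12 : no_int_root 0 12. Proof. no_int_root_tac. Qed.
Lemma no_int_root_2_2 : no_int_root 2 2. Proof. no_int_root_tac. Qed.
Lemma no_int_root_N1_4 : no_int_root (-1) 4. Proof. no_int_root_tac. Qed.
Lemma no_int_root_1_4 : no_int_root 1 4. Proof. no_int_root_tac. Qed.
Lemma no_int_root_1_3 : no_int_root 1 3. Proof. no_int_root_tac. Qed.

(** * Obstructions in the group algebra *)

Section Normalized.

Variables (gT : finGroupType) (G : {group gT}).
Implicit Types (g h s t w x : gT) (l : seq gT) (V : 'M[algC]_#|G|).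
Notation U := (regmx G).

(** For a combination of the [U g] this is the coefficient of the identity, since [U g] has trace 0
    for [g <> 1]. It serves to show that [V] is not zero. *)
Definition coef_one V : algC := (\tr V / #|G|%:R)%R.

Lemma coef_oneD V W : coef_one (V + W)%R = (coef_one V + coef_one W)%R.
Proof. by rewrite /coef_one linearD mulrDl. Qed.

Lemma coef_oneN V : coef_one (- V)%R = (- coef_one V)%R.
Proof. by rewrite /coef_one linearN mulNr. Qed.

Lemma coef_one_regmx g : coef_one (U g) = (g == 1)%g%:R%R.
Proof.
rewrite /coef_one mxtrace_regmx -mulr_natr mulfK //.
by rewrite pnatr_eq0 -lt0n cardG_gt0.
Qed.

Lemma coef_one_1 : coef_one 1%R = 1%R.
Proof. by rewrite -(regmx1 G) coef_one_regmx eqxx. Qed.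

Definition coef_oneE := (coef_oneD, coef_oneN, coef_one_1, coef_one_regmx).

Lemma in_class_quad k (l : seq gT) (V : 'M[algC]_#|G|) (b c : int) :
    in_class k G -> no_int_root b c -> size l <= k -> uniq l -> all (mem G) l -> 1 \notin
      l ->
    all (fun x => x^-1 \in l) l -> coef_one V != 0%R ->
    let T := (\sum_(x <- l) regmx G x)%R in
  (V * T * T = b%:~R *: (V * T) + c%:~R *: V)%R -> False.
Proof.
move=> Gk bc lk ul lG l1 lV V1 T E; suff [r] : exists r, (r * r = b * r + c)%R by apply: bc.
apply: quadratic_int_root E; first exact: in_class_spectrum Gk _ _ _ _ _.
by apply: mxtrace_neq0; apply: contraNneq V1; rewrite /coef_one => ->; rewrite mul0r.
Qed.

Definition conn_seq (l : seq gT) :=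
  [&& uniq l, all (mem G) l, 1 \notin l & all (fun x => x^-1 \in l) l].

Lemma conn_seq_pair x l :
  conn_seq l -> x \in G -> x ^+ 2 != 1 -> x \notin l -> conn_seq [:: x, x^-1 & l].
Proof.
case/and4P=> ul lG l1 /allP lV Gx x2 lx; have lxV : x^-1 \notin l.
  by apply: contra lx => /lV; rewrite invgK.
rewrite /conn_seq /= !inE !negb_or lx lxV ul Gx groupV Gx lG l1 invgK !eqxx orbT /=.
rewrite andbT [x == _]eq_sym eq_invg_mul x2 [1 == x^-1]eq_sym eq_invg1 [1 == x]eq_sym.
rewrite (contra _ x2) /=; last by move/eqP->; rewrite expg1n.
by apply/allP=> y /lV; rewrite !inE => ->; rewrite !orbT.
Qed.

Lemma conn_seq_invol x l :
  conn_seq l -> x \in G -> x != 1 -> x ^+ 2 = 1 -> x \notin l -> conn_seq (x :: l).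
Proof.
case/and4P=> ul lG l1 /allP lV Gx x1 x2 lx.
rewrite /conn_seq /= !inE !negb_or lx ul Gx lG l1 (invg_expg2 x2) eqxx [1 == x]eq_sym x1 /=.
by apply/allP=> y /lV; rewrite !inE => ->; rewrite !orbT.
Qed.

(** The quadratic relation is multiplied out into words [V * U (s * t)], which are then simplified
    by computing in the group. *)
Lemma in_class_words k (l : seq gT) (V : 'M[algC]_#|G|) (b c : int) :
    in_class k G -> no_int_root b c -> size l <= k -> conn_seq l -> coef_one V != 0%R ->
    (\sum_(s <- l) \sum_(t <- l) V * U (s * t)%g =
       b%:~R *: (\sum_(s <- l) V * U s) + c%:~R *: V)%R -> False.
Proof.
move=> Gk bc lk /and4P[ul lG l1 lV] V1 E; apply: (in_class_quad Gk bc lk ul lG l1 lV V1).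
have -> : (V * (\sum_(s <- l) U s) = \sum_(s <- l) V * U s)%R by rewrite mulr_sumr.
rewrite -E mulr_suml big_seq [RHS]big_seq; apply: eq_bigr => s ls.
rewrite mulr_sumr; apply: eq_bigr => t _.
by rewrite -GRing.mulrA -regmxM //; apply: (allP lG).
Qed.

Lemma regmx_sum V w (l : seq gT) : w \in G ->
  (V * U w * (\sum_(s <- l) U s) = \sum_(s <- l) V * U (w * s)%g)%R.
Proof.
move=> Gw; rewrite mulr_sumr; apply: eq_bigr => s _.
by rewrite regmxM // GRing.mulrA.
Qed.

Lemma regmx_fix V t w : t \in G -> (V * U t = V)%R -> (V * U (t * w)%g = V * U w)%R.
Proof. by move=> Gt Vt; rewrite regmxM // GRing.mulrA Vt. Qed.

Lemma regmx_opp V t w : t \in G -> (V * U t = - V)%R ->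
  (V * U (t * w)%g = - (V * U w))%R.
Proof. by move=> Gt Vt; rewrite regmxM // GRing.mulrA Vt mulNr. Qed.

Lemma regmx_comm g h : g \in G -> h \in G -> commute g h -> GRing.comm (U g) (U h).
Proof. by move=> Gg Gh cgh; rewrite /GRing.comm -!regmxM // cgh. Qed.

(** Up to a scalar, [1 + U h] projects to the space where [h = 1]. The next three lemmas do the same
    for [h = -1], for [h = 1] with [h] of order 3, and for the complement of the latter space, where
    [h + h^-1 = -1]. *)
Lemma sym_part h : h \in G -> h ^+ 2 = 1 -> ((1 + U h) * U h = 1 + U h)%R.
Proof.
by move=> Gh h2; rewrite mulrDl GRing.mul1r -regmxM // -[h * h]/(h ^+ 2) h2 regmx1
  GRing.addrC.
Qed.

Lemma opp_part h : h \in G -> h ^+ 2 = 1 -> ((1 - U h) * U h = - (1 - U h))%R.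
Proof.
move=> Gh h2; rewrite mulrBl GRing.mul1r -regmxM // -[h * h]/(h ^+ 2) h2 regmx1.
by rewrite opprB.
Qed.

Lemma fix3_part h : h \in G -> h ^+ 3 = 1 ->
  ((1 + U h + U h^-1) * U h = 1 + U h + U h^-1)%R.
Proof.
move=> Gh h3; have Dh := invg_expg3 h3.
rewrite !mulrDl GRing.mul1r -!regmxM ?groupV // mulVg Dh regmx1.
by rewrite GRing.addrC GRing.addrA.
Qed.

Lemma move3_part h : h \in G -> h ^+ 3 = 1 -> let V := (1 + 1 - U h - U h^-1)%R in
  (V * U h + V * U h^-1 = - V)%R.
Proof.
move=> Gh h3 V; have Dh := invg_expg3 h3.
have DhV : h^-1 * h^-1 = h by rewrite -invMg Dh invgK.
rewrite /V !mulrBl -!regmxM ?groupV // mulVg mulgV Dh DhV regmx1.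
rewrite !mulrDl !GRing.mul1r; mx_linear.
Qed.

End Normalized.

(** * Orders of elements and products of two involutions *)

Section Class4.

Variables (gT : finGroupType) (G : {group gT}).
Hypothesis G4 : in_class 4 G.
Implicit Types (g h s t x y : gT) (V : 'M[algC]_#|G|).
Notation U := (regmx G).

(** Take a primitive root of unity [w] of the order of [s]. The sum [V] of the [w^-i s^i] projects
    to the [w]-eigenspace of [s], so [w + w^-1] is an eigenvalue of the sum over [{s, s^-1}] and
    must be an integer. *)
Lemma class_order s : s \in G -> s ^+ 4 = 1 \/ s ^+ 6 = 1.
Proof.
move=> Gs; have [s2 | s2] := eqVneq (s ^+ 2) 1.
  by left; rewrite (expgM s 2 2) s2 expg1n.
have [w pw] := C_prim_root_exists (order_gt0 s).
have w0 : w != 0%R by rewrite (prim_root_eq0 pw) -lt0n order_gt0.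
pose f i : 'M[algC]_#|G| := ((w^-1 ^+ i)%R *: U (s ^+ i))%R.
pose V : 'M[algC]_#|G| := (\sum_(i < #[s]) f i)%R.
have VN0 : V != 0%R.
  apply: mxtrace_neq0; rewrite /V linear_sum /= (bigD1 (Ordinal (order_gt0 s))) //=.
  rewrite big1 ?GRing.addr0 => [|i neq_i0].
    rewrite /f !expr0 scale1r mxtrace_regmx eqxx pnatr_eq0 -lt0n.
    exact: cardG_gt0.
  rewrite /f mxtraceZ mxtrace_regmx -order_dvdn gtnNdvd ?GRing.mul0rn ?GRing.mulr0 //.
  by rewrite lt0n; apply: contra neq_i0 => /eqP i0; apply/eqP/val_inj.
have fS i : (f i * U s = w *: f i.+1)%R.
  by rewrite /f scaler_mulmx -regmxM ?groupX // -expgSr scalerA exprS mulVKf.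
have VU : (V * U s = w *: V)%R.
  rewrite /V mulr_suml scaler_sumr; under eq_bigr do rewrite fS.
  rewrite -!scaler_sumr; congr (_ *: _)%R; apply: (addrI (f 0%N)).
  rewrite -(big_ord_recl #[s] (fun i => f i)) big_ord_recr /= GRing.addrC.
  by rewrite /f expg_order exprVn (prim_expr_order pw) invr1 expr0.
have VUV : (V * U s^-1 = w^-1 *: V)%R.
  apply: (scalerI w0); rewrite scalerA divff // scale1r -scaler_mulmx -VU.
  by rewrite -GRing.mulrA -regmxM // mulgV regmx1 GRing.mulr1.
have iT : int_spectrum (\sum_(x <- [:: s; s^-1]%g) U x)%R.
  apply: in_class_spectrum G4 _ _ _ _ _ => //=.
  - by rewrite andbT inE eq_sym eq_invg_mul.
  - by rewrite Gs groupV Gs.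
  - rewrite !inE !(eq_sym 1) eq_invg1 orbb.
    by apply: contra s2 => /eqP->; rewrite expg1n.
  - by rewrite !inE invgK !eqxx orbT.
have /iT iw : eigenvalue (\sum_(x <- [:: s; s^-1]%g) U x)%R (w + w^-1)%R.
  apply: left_eigenvalue VN0 _.
  by rewrite !big_cons big_nil GRing.addr0 mulrDr VU VUV scalerDl.
by case: (unity_root_trace_int pw iw); rewrite order_dvdn => /eqP; [left | right].
Qed.

(* With a = s t, the square of s + t is 2 + a + a^-1; it equals 2 where a^2 = -1,
   and 3 where a is a primitive sixth root of unity. *)
Lemma class_mul_involution s t : s \in G -> t \in G -> s ^+ 2 = 1 -> t ^+ 2 = 1 ->
  (s * t) ^+ 2 = 1 \/ (s * t) ^+ 3 = 1.
Proof.
move=> Gs Gt s2 t2; set a := s * t; have Ga : a \in G by rewrite groupM.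
have [a2 | a2] := eqVneq (a ^+ 2) 1; first by left.
have [a3 | a3] := eqVneq (a ^+ 3) 1; first by right.
have sV := invg_expg2 s2; have tV := invg_expg2 t2.
have s1 : s != 1 by apply: contra a2 => /eqP; rewrite /a => ->; rewrite mul1g t2.
have t1 : t != 1 by apply: contra a2 => /eqP; rewrite /a => ->; rewrite mulg1 s2.
have st : s != t by apply: contra a2 => /eqP; rewrite /a => ->; rewrite -expg2E t2 expg1n.
have aV : t * s = a^-1 by rewrite invMg sV tV.
have sq V : (V * (\sum_(x <- [:: s; t]) U x) * (\sum_(x <- [:: s; t]) U x) =
  V + V + (V * U a + V * U a^-1))%R.
  rewrite -[V in LHS]GRing.mulr1 -(regmx1 G) regmx_sum // !big_cons !big_nil.
  rewrite !mul1g !GRing.addr0 mulrDl !mulrDr -!(GRing.mulrA V) -!regmxM // aV -!expg2E s2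
    t2.
  rewrite regmx1 GRing.mulr1 -/a; mx_linear.
have quad V c : no_int_root 0 (2 + c)%R -> coef_one V != 0%R ->
    (V * U a + V * U a^-1 = c%:~R *: V)%R -> False.
  move=> bc V1 Vc; apply: (in_class_quad G4 bc (l := [:: s; t]) _ _ _ _ _ V1) => //=.
  - by rewrite inE st.
  - by rewrite Gs Gt.
  - by rewrite !inE !(eq_sym 1) negb_or s1.
  - by rewrite sV tV !inE !eqxx orbT.
  by rewrite sq Vc rmorphD /=; mx_linear.
have [a4 | a6] := class_order Ga.
  case: (quad (1 - U (a ^+ 2))%R 0%R); first exact: no_int_root_2.
    by rewrite !coef_oneE (negPf a2) GRing.subr0 oner_eq0.
  rewrite scale0r !mulrBl !GRing.mul1r -!regmxM ?groupX //.
  rewrite -expgSr expg2E mulgK (_ : a ^+ 3 = a^-1); last first.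
    by apply/eqP; rewrite eq_sym eq_invg_mul -expgS a4.
  mx_linear.
have a4 : a ^+ 4 != 1.
  by apply: contra a2 => /eqP a4; rewrite -a6 (expgD a 4 2) a4 mul1g.
(* The factor [1 - a^3] imposes [a^3 = -1] and [1 + a] excludes [a = -1]. What remains are the
   primitive sixth roots of unity, where [a + a^-1 = 1]. *)
case: (quad ((1 - U (a ^+ 3)) * (1 + U a))%R 1%R); first exact: no_int_root_3.
  rewrite mulrDr GRing.mulr1 mulrBl GRing.mul1r -regmxM ?groupX // -expgSr !coef_oneE.
  rewrite (negPf a3) (negPf a4) (_ : a == 1 = false); last first.
    by apply: contraNF a2 => /eqP->; rewrite expg1n.
  by rewrite !GRing.subr0 GRing.addr0 oner_eq0.
pose E k := U (a ^+ k).
have EM k m : (E k * E m = E (k + m)%N)%R by rewrite /E expgD regmxM ?groupX.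
have E6 k : E (k + 6)%N = E k by rewrite /E expgD a6 mulg1.
have aV5 : a^-1 = a ^+ 5 by apply/eqP; rewrite eq_invg_mul -expgS a6.
have E0 : E 0%N = 1%R by exact: regmx1.
have E1 : E 1%N = U a by [].
rewrite aV5 mulr1z scale1r -/(E 3%N) -/(E 5%N) -E1 -E0.
rewrite !(mulrDl, mulrDr, mulrBl, mulrBr, mulNr, GRing.mulrN) !EM /=.
rewrite -[E (0 + 0 + 1 + 5)%N]/(E (0 + 6)%N) -[E (3 + 0 + 5)%N]/(E (2 + 6)%N).
rewrite -[E (3 + 0 + 1 + 5)%N]/(E (3 + 6)%N) !E6.
rewrite -[E (0 + 0 + 1)%N]/(E 1%N) -[E (0 + 0 + 1 + 1)%N]/(E 2%N) -[E (0 + 0)%N]/(E 0%N).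
rewrite -[E (3 + 0 + 1)%N]/(E 4%N) -[E (3 + 0 + 1 + 1)%N]/(E (0 + 0 + 5)%N) -[E (3 +
  0)%N]/(E 3%N).
mx_linear.
Qed.

End Class4.

(** * Local obstructions in class 4 *)

Ltac group_nf :=
  repeat progress rewrite ?(conjgE, invMg, invgK, invg1, mulgA) ?(mulgK, mulgKV, mulVg,
    mulgV, mul1g, mulg1).

Lemma p_elt_expg_prime (gT : finGroupType) (p q : nat) (z : gT) :
  prime q -> p != q -> p.-elt z -> z ^+ q = 1 -> z = 1.
Proof.
move=> pq neq_pq pz /eqP; rewrite -order_dvdn => /(prime_nt_dvdP pq) dvd_zq.
apply/eqP; rewrite -order_eq1; apply: contraT => /dvd_zq zq.
by move: pz; rewrite /p_elt zq pnatE // inE /= eq_sym (negPf neq_pq).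
Qed.

(** * Involutions in 2-subgroups *)

Section Class4.

Variables (gT : finGroupType) (G : {group gT}).
Hypothesis G4 : in_class 4 G.
Implicit Types (g h s t x y : gT) (V : 'M[algC]_#|G|) (Q : {group gT}).
Notation U := (regmx G).

Lemma class_2elt z : z \in G -> 2.-elt z -> z ^+ 4 = 1.
Proof.
move=> Gz z2; case: (class_order G4 Gz) => // z6.
have z2_1 : z ^+ 2 = 1.
  by apply: (@p_elt_expg_prime _ 2 3); rewrite ?p_eltX // -expgM.
by rewrite (expgM z 2 2) z2_1 expg1n.
Qed.

Lemma class_2group_involutions Q s t : Q \subset G -> 2.-group Q ->
  s \in Q -> t \in Q -> s ^+ 2 = 1 -> t ^+ 2 = 1 -> commute s t.
Proof.
move=> sQG Q2 Qs Qt s2 t2.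
have st2 : (s * t) ^+ 2 = 1.
  have [//|st3] := class_mul_involution G4 (subsetP sQG s Qs) (subsetP sQG t Qt) s2 t2.
  rewrite (_ : s * t = 1) ?expg1n //.
  by apply: (@p_elt_expg_prime _ 2 3) => //; apply: mem_p_elt Q2 _; rewrite groupM.
rewrite /commute -[t * s]invgK -{2}(invg_expg2 s2) -{2}(invg_expg2 t2) -invMg invgK.
by rewrite (invg_expg2 st2).
Qed.

(* Where x^2 = 1 and t t^x = -1, the elements x and t anticommute, so that
   (x + x^-1 + t)^2 = (2 x + t)^2 = 5. *)
Lemma class_2group_invol_central Q x t : Q \subset G -> 2.-group Q ->
  x \in Q -> t \in Q -> t ^+ 2 = 1 -> commute x t.
Proof.
move=> sQG Q2 Qx Qt t2; have [Gx Gt] := (subsetP sQG x Qx, subsetP sQG t Qt).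
have [x2 | x2] := eqVneq (x ^+ 2) 1; first exact: class_2group_involutions Q2 _ _ _ _.
have x4 : x ^+ 4 = 1 by apply: class_2elt => //; apply: mem_p_elt Q2 Qx.
have x22 : (x ^+ 2) ^+ 2 = 1 by rewrite -expgM.
have tx2 : (t ^ x) ^+ 2 = 1 by rewrite -conjXg t2 conj1g.
have cx2t : commute (x * x) t.
  by apply: class_2group_involutions Q2 _ _ _ _; rewrite ?groupM.
have cttx : commute t (t ^ x).
  by apply: class_2group_involutions Q2 _ _ _ _; rewrite ?groupJ.
have tV := invg_expg2 t2.
have xV := invg_expg4 x4.
apply/eqP; apply: contraT => nxt; pose c := t * t ^ x.
have txt : t ^ x != t.
  by apply: contra nxt => /eqP txt; rewrite /commute (conjgC t) txt.
have c1 : c != 1 by apply: contra txt => /eqP/mulg1_eq; rewrite tV => <-.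
(* If [c = x^2], then [(x t)^2 = x^2 c = 1], so [x t] commutes with [t], and then so does [x]. *)
have cx2 : c != x * x.
  apply: contra nxt => /eqP cx2; have xt2 : (x * t) ^+ 2 = 1.
    rewrite expg2E (_ : _ * _ = x * x * (t ^ x * t)); last by group_nf.
    by rewrite -cttx -/c cx2 -!expg2E x22.
  have : commute (x * t) t by apply: class_2group_involutions Q2 _ _ _ _; rewrite ?groupM.
  by rewrite /commute mulgA => /mulIg ->.
have c2 : c ^+ 2 = 1 by rewrite expgMn // t2 tx2 mulg1.
have Gc : c \in G by rewrite groupM ?groupJ.
have cxc : commute (x * x) c.
  apply: class_2group_involutions Q2 _ _ _ _ => //; first by rewrite groupM.
  by rewrite groupM ?groupJ.
pose V := ((1 + U (x * x)) * (1 - U c))%R.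
have Vc : (V * U c = - V)%R by rewrite /V -GRing.mulrA opp_part // mulrN.
have Vx2 : (V * U (x * x) = V)%R.
  have cm : GRing.comm (1 - U c)%R (U (x * x)).
    apply/commr_sym/commrB; first exact: commr1.
    by apply: regmx_comm => //; rewrite groupM.
  by rewrite /V -GRing.mulrA cm GRing.mulrA sym_part ?groupM.
have Ext : x * t = c * (t * x).
  have -> : c * (t * x) = t ^ x * x.
    by rewrite /c cttx -mulgA (mulgA t) -expg2E t2 mul1g.
  have {1}-> : t = t ^ (x * x) by rewrite conjgE -cx2t mulKg.
  by group_nf.
exfalso; apply: (@in_class_words _ _ _ [:: x; x^-1; t] V 0%R 5 G4) => //.
- exact: no_int_root_5.
- apply: conn_seq_pair => //; last first.
    by rewrite inE; apply: contra x2 => /eqP->; rewrite t2.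
  by apply: conn_seq_invol => //; apply: contra nxt => /eqP->; rewrite /commute mul1g mulg1.
- rewrite /V mulrBr GRing.mulr1 mulrDl GRing.mul1r -regmxM ?groupM // !coef_oneE (negPf
  c1) (negPf x2).
  rewrite (_ : x * x * c == 1 = false) ?GRing.mulr0n; last first.
    by rewrite -eq_invg_mul -expg2E (invg_expg2 x22) eq_sym (negPf cx2).
  by rewrite !(GRing.addr0, GRing.subr0) oner_eq0.
have ExVxV : x^-1 * x^-1 = x * x by rewrite -invMg -!expg2E (invg_expg2 x22).
have ExVt : x^-1 * t = x * x * (x * t) by rewrite xV !mulgA.
have EtxV : t * x^-1 = x * x * (t * x) by rewrite xV mulgA -cx2t -!mulgA.
have fx w : (V * U (x * x * w)%g = V * U w)%R by apply: regmx_fix => //; rewrite groupM.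
have fc w : (V * U (c * w)%g = - (V * U w))%R by apply: regmx_opp.
rewrite !big_cons !big_nil mulgV mulVg ExVxV ExVt EtxV !Ext.
rewrite -[t * t]expg2E t2 regmx1 !fx !fc Vx2 GRing.mulr1; mx_linear.
Qed.

End Class4.

Ltac ring_expand :=
  rewrite !(mulrDl, mulrDr, mulrBl, mulrBr, mulNr, GRing.mulrN, GRing.mul1r, GRing.mulr1).

Ltac coef_simp :=
  rewrite /= ?GRing.mulr0n; repeat progress rewrite ?(GRing.oppr0, GRing.addr0,
    GRing.subr0, GRing.add0r).

Lemma add1_nat_neq0 (b : bool) : (1 + b%:R != 0 :> algC)%R.
Proof. by rewrite -(natrD _ 1 b) pnatr_eq0. Qed.

Lemma eq_mulg1_invol (gT : finGroupType) (z c : gT) : z ^+ 2 = 1 ->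
  (z * c == 1) = (c == z).
Proof. by move=> z2; rewrite -eq_invg_mul (invg_expg2 z2) eq_sym. Qed.

(** * Products of projections *)

Section Parts.

Variables (gT : finGroupType) (G : {group gT}).
Implicit Types (g h s t x y z : gT) (A B V : 'M[algC]_#|G|).
Notation U := (regmx G).

Lemma mul_part_act A B t e : GRing.comm B (U t) -> (A * U t = e)%R -> (A * B * U t = e *
  B)%R.
Proof. by move=> cB <-; rewrite -GRing.mulrA cB GRing.mulrA. Qed.

Lemma sym_part_comm h t : h \in G -> t \in G -> commute h t -> GRing.comm (1 + U h)%R (U t).
Proof.
move=> Gh Gt cht; apply/commr_sym/commrD; first exact: commr1.
exact/commr_sym/regmx_comm.
Qed.

Lemma opp_part_comm h t : h \in G -> t \in G -> commute h t -> GRing.comm (1 - U h)%R (U t).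
Proof.
move=> Gh Gt cht; apply/commr_sym/commrB; first exact: commr1.
exact/commr_sym/regmx_comm.
Qed.

Lemma move3_part_comm h t : h \in G -> t \in G -> commute h t ->
  GRing.comm (1 + 1 - U h - U h^-1)%R (U t).
Proof.
move=> Gh Gt cht; apply/commr_sym; do 2?apply: commrB.
- by apply: commrD; apply: commr1.
- exact/commr_sym/regmx_comm.
by apply/commr_sym/regmx_comm; rewrite ?groupV //; apply/commute_sym/commuteV.
Qed.

(* Up to a scalar, the projection to the space where x = 1 and y <> 1. *)
Definition split3 x y : 'M[algC]_#|G| :=
  ((1 + U x + U x^-1) * (1 + 1 - U y - U y^-1))%R.

(** In other words, [x] and [y] generate an elementary abelian group of order 9. *)
Definition indep3 x y :=
  [/\ x ^+ 3 = 1, y ^+ 3 = 1, commute x y, x != 1 & [/\ y != 1, y != x & y != x^-1]].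

Lemma split3_fix x y : x \in G -> y \in G -> indep3 x y -> (split3 x y * U x = split3 x
  y)%R.
Proof.
move=> Gx Gy [x3 y3 cxy _ _]; apply: etrans (mul_part_act _ (fix3_part Gx x3)) _ => //.
exact: move3_part_comm.
Qed.

Lemma split3_fixV x y : x \in G -> y \in G -> indep3 x y -> (split3 x y * U x^-1 = split3
  x y)%R.
Proof.
by move=> Gx Gy ixy; rewrite -{1}(split3_fix Gx Gy ixy) -GRing.mulrA -regmxM // mulgV
  regmx1 GRing.mulr1.
Qed.

Lemma split3_move x y : x \in G -> y \in G -> indep3 x y ->
  (split3 x y * U y + split3 x y * U y^-1 = - split3 x y)%R.
Proof.
by move=> Gx Gy [_ y3 _ _ _]; rewrite /split3 -!GRing.mulrA -mulrDr move3_part //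
  GRing.mulrN.
Qed.

Lemma split3_expand x y : x \in G -> y \in G ->
  split3 x y = (1 + 1 - U y - U y^-1 + (U x + U x - U (x * y)%g - U (x * y^-1)%g)
    + (U x^-1 + U x^-1 - U (x^-1 * y)%g - U (x^-1 * y^-1)%g))%R.
Proof.
move=> Gx Gy; rewrite /split3 !regmxM ?groupV //.
ring_expand; mx_linear.
Qed.

Lemma split3_words x y : x \in G -> y \in G -> indep3 x y ->
  [/\ (y == 1) = false, (x * y == 1) = false, (x * y^-1 == 1) = false,
      (x^-1 * y == 1) = false & (x^-1 * y^-1 == 1) = false].
Proof.
move=> Gx Gy [_ _ _ _ [y1 yx yxV]]; rewrite -!eq_invg_mul !invgK ![x^-1 == _]eq_sym ![x ==
  _]eq_sym.
by rewrite (inj_eq invg_inj) eq_invg_sym (negPf y1) (negPf yx) (negPf yxV); split.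
Qed.

Lemma split3_coef x y : x \in G -> y \in G -> indep3 x y -> coef_one (split3 x y) != 0%R.
Proof.
move=> Gx Gy ixy; have [_ _ _ x1 _] := ixy.
have [E1 E2 E3 E4 E5] := split3_words Gx Gy ixy.
rewrite split3_expand // !coef_oneE !eq_invg1 E1 E2 E3 E4 E5 (negPf x1).
by rewrite !GRing.mulr0n !(GRing.addr0, GRing.subr0) -(natrD _ 1 1) pnatr_eq0.
Qed.

End Parts.

(** * Commutators in 2-subgroups, and elements of order 3 *)

Section Class4.

Variables (gT : finGroupType) (G : {group gT}).
Hypothesis G4 : in_class 4 G.
Implicit Types (g h s t x y : gT) (V : 'M[algC]_#|G|) (Q : {group gT}).
Notation U := (regmx G).

(** Squares satisfy [z^2 = 1], hence are central in [Q], and [[x, y] = x^-2 (x y^-1)^2 y^2] is a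
    product of squares. Then [x^2 = (x^2)^y = (x [x, y])^2 = x^2 [x, y]^2]. *)
Lemma class_2group_commg_central Q x y : Q \subset G -> 2.-group Q ->
  x \in Q -> y \in Q -> (forall w, w \in Q -> commute [~ x, y] w) /\ [~ x, y] ^+ 2 = 1.
Proof.
move=> sQG Q2 Qx Qy.
have sq2 z : z \in Q -> (z * z) ^+ 2 = 1.
  by move=> Qz; rewrite -expg2E -expgM (class_2elt G4) ?(subsetP sQG) ?(mem_p_elt Q2).
have sqc z w : z \in Q -> w \in Q -> commute (z * z) w.
  move=> Qz Qw; apply/commute_sym.
  by apply: (class_2group_invol_central G4 sQG Q2) => //; [rewrite groupM | apply: sq2].
have QxyV : x * y^-1 \in Q by rewrite groupM ?groupV.
have cc w : w \in Q -> commute [~ x, y] w.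
  have -> : [~ x, y] = (x * x)^-1 * (x * y^-1 * (x * y^-1)) * (y * y).
    by rewrite commgEl; group_nf.
  move=> Qw; apply/commute_sym/commuteM; last exact/commute_sym/sqc.
  by apply/commuteM; [apply/commuteV |]; apply/commute_sym/sqc.
split=> //; apply: (mulgI (x ^+ 2)); rewrite mulg1 -expgMn; last exact/commute_sym/cc.
by rewrite -conjg_mulR -conjXg conjgE [x ^+ 2]expg2E (sqc x y Qx Qy) mulKg.
Qed.

Lemma class_2group_swap Q x y : Q \subset G -> 2.-group Q ->
  x \in Q -> y \in Q -> y * x = [~ x, y] * (x * y).
Proof.
move=> sQG Q2 Qx Qy; have [cc c2] := class_2group_commg_central sQG Q2 Qx Qy.
rewrite (cc (x * y)) ?groupM // -[[~ x, y]](invg_expg2 c2) invg_comm commgEl conjgE.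
by group_nf.
Qed.

(* Where x^2 = y^2 = 1 and [x, y] = -1, the elements x and y anticommute, so that
   (x + x^-1 + y + y^-1)^2 = 4 (x + y)^2 = 8. *)
Lemma class_2group_commg Q x y : Q \subset G -> 2.-group Q -> x \in Q -> y \in Q ->
  [~ x, y] \in [:: 1; x * x; y * y; x * x * (y * y)].
Proof.
move=> sQG Q2 Qx Qy; have [Gx Gy] := (subsetP sQG x Qx, subsetP sQG y Qy).
have [cc c2] := class_2group_commg_central sQG Q2 Qx Qy; set c := [~ x, y] in cc c2 *.
have sq2 z : z \in Q -> (z * z) ^+ 2 = 1.
  by move=> Qz; rewrite -expg2E -expgM (class_2elt G4) ?(subsetP sQG) ?(mem_p_elt Q2).
have sqc z w : z \in Q -> w \in Q -> commute (z * z) w.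
  move=> Qz Qw; apply/commute_sym.
  by apply: (class_2group_invol_central G4 sQG Q2) => //; [rewrite groupM | apply: sq2].
have Qc : c \in Q by rewrite groupR.
have Gc := subsetP sQG c Qc.
apply: contraT; rewrite !inE !negb_or => /and4P[c1 cx cy cxy]; exfalso.
have ncxy : ~ commute x y by move/commgP; rewrite (negPf c1).
have x2 : x ^+ 2 != 1.
  apply/eqP=> x2; case: ncxy; apply/commute_sym.
  exact: (class_2group_invol_central G4 sQG Q2).
have y2 : y ^+ 2 != 1.
  apply/eqP=> y2; case: ncxy; exact: (class_2group_invol_central G4 sQG Q2).
have xV := invg_expg4 (class_2elt G4 Gx (mem_p_elt Q2 Qx)).
have yV := invg_expg4 (class_2elt G4 Gy (mem_p_elt Q2 Qy)).
have [Gxx Gyy] : x * x \in G /\ y * y \in G by rewrite !groupM.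
have xy2 : (x * x * (y * y)) ^+ 2 = 1.
  by rewrite expgMn ?sq2 ?mulg1 //; apply: sqc; rewrite ?groupM.
have cxxyy : commute (x * x) (y * y) by apply: sqc; rewrite ?groupM.
pose V := ((1 + U (x * x)) * (1 + U (y * y)) * (1 - U c))%R.
have Vc : (V * U c = - V)%R by rewrite /V -GRing.mulrA opp_part // GRing.mulrN.
have cC z : z \in Q -> GRing.comm (1 - U c)%R (U (z * z)).
  by move=> Qz; apply: opp_part_comm => //; [apply: (subsetP sQG) | apply: cc];
    rewrite groupM.
have Vyy : (V * U (y * y) = V)%R.
  apply: mul_part_act; first exact: cC.
  by rewrite -GRing.mulrA sym_part ?sq2.
have Vxx : (V * U (x * x) = V)%R.
  apply: mul_part_act; first exact: cC.
  apply: mul_part_act; last by rewrite sym_part ?sq2.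
  exact: sym_part_comm.
have fx w : (V * U (x * x * w)%g = V * U w)%R by apply: regmx_fix.
have fy w : (V * U (y * y * w)%g = V * U w)%R by apply: regmx_fix.
have fc w : (V * U (c * w)%g = - (V * U w))%R by apply: regmx_opp.
have lxV w : (V * U (x^-1 * w)%g = V * U (x * w)%g)%R by rewrite xV -(mulgA (x * x)) fx.
have lyV w : (V * U (y^-1 * w)%g = V * U (y * w)%g)%R by rewrite yV -(mulgA (y * y)) fy.
have rxV w : w \in Q -> (V * U (w * x^-1)%g = V * U (w * x)%g)%R.
  by move=> Qw; rewrite xV (mulgA w) -(sqc x w Qx Qw) -mulgA fx.
have ryV w : w \in Q -> (V * U (w * y^-1)%g = V * U (w * y)%g)%R.
  by move=> Qw; rewrite yV (mulgA w) -(sqc y w Qy Qw) -mulgA fy.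
have Eyx : y * x = c * (x * y) := class_2group_swap sQG Q2 Qx Qy.
apply: (@in_class_words _ _ _ [:: x; x^-1; y; y^-1] V 0%R 8 G4) => //.
- exact: no_int_root_8.
- do 2?[apply: conn_seq_pair => //]; rewrite !inE negb_or.
  by apply/andP; split; apply/eqP=> Dx; case: ncxy; rewrite Dx //;
    apply/commute_sym/commuteV.
- rewrite /V; ring_expand; rewrite -!regmxM ?groupM // !coef_oneE.
  rewrite (eq_mulg1_invol c (sq2 x Qx)) (eq_mulg1_invol c (sq2 y Qy)) (eq_mulg1_invol c
    xy2) (negPf c1) (negPf cx) (negPf cy) (negPf cxy).
  rewrite (negPf x2 : (x * x == 1) = false) (negPf y2 : (y * y == 1) = false).
  (* The coefficient is 1, or 2 when [x^2 = y^2]. *)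
  by coef_simp; apply: add1_nat_neq0.
rewrite !big_cons !big_nil !lxV !lyV !rxV ?ryV // !Eyx !fc Vxx Vyy; mx_linear.
Qed.

(** The commutator values 1 and [x^2] give [x] and [x^-1]. If the value is [y^2], the pair [x],
    [x y] has the same commutator and [(x y)^2 = x^2], which leads back to these two values. If it
    is [x^2 y^2], then [(x y)^2 = 1], so [x y] is central in [Q] and [x] commutes with [y]. *)
Lemma class_2group_conj Q x y : Q \subset G -> 2.-group Q -> x \in Q -> y \in Q ->
  x ^ y = x \/ x ^ y = x^-1.
Proof.
move=> sQG Q2 Qx Qy; have [Gx Gy] := (subsetP sQG x Qx, subsetP sQG y Qy).
have [cc c2] := class_2group_commg_central sQG Q2 Qx Qy.
have xV := invg_expg4 (class_2elt G4 Gx (mem_p_elt Q2 Qx)).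
have Dxy : x ^ y = x * [~ x, y] by rewrite conjg_mulR.
have finish : [~ x, y] = 1 \/ [~ x, y] = x * x -> x ^ y = x \/ x ^ y = x^-1.
  by case=> E; rewrite Dxy E ?mulg1 ?xV ?mulgA; [left | right].
have sq2 z : z \in Q -> (z * z) * (z * z) = 1.
  by move=> Qz; rewrite -!expg2E -expgM (class_2elt G4) ?(subsetP sQG) ?(mem_p_elt Q2).
have sqc z w : z \in Q -> w \in Q -> commute (z * z) w.
  move=> Qz Qw; apply/commute_sym.
  by apply: (class_2group_invol_central G4 sQG Q2) => //; [rewrite groupM | apply: sq2].
have Exy : x * y * (x * y) = [~ x, y] * (x * x * (y * y)).
  have aux c : y * x = c * (x * y) -> commute c x ->
      x * y * (x * y) = c * (x * x * (y * y)).
    by move=> E C; rewrite -!mulgA (mulgA y x) E -!mulgA (mulgA x) -C -!mulgA.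
  by apply: aux; [apply: class_2group_swap Q2 Qx Qy | apply: cc].
have := class_2group_commg sQG Q2 Qx Qy; rewrite !inE => /or4P[] /eqP Ec.
- by apply: finish; left.
- by apply: finish; right.
- have := class_2group_commg sQG Q2 Qx (groupM Qx Qy).
  have -> : [~ x, x * y] = [~ x, y] by rewrite !commgEl conjgM (conjgE x x) mulKg.
  have -> : x * y * (x * y) = x * x by rewrite Exy Ec (sqc y _ Qy) ?groupM // -mulgA sq2
    // mulg1.
  rewrite !inE sq2 // => /or4P[] /eqP E; apply: finish; by [left | right].
left; have xy2 : (x * y) ^+ 2 = 1 by rewrite expg2E Exy -Ec -expg2E.
have : commute x (x * y).
  by apply: (class_2group_invol_central G4 sQG Q2) => //; rewrite groupM.
rewrite /commute -mulgA => /mulgI cxy.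
by rewrite conjgE cxy mulKg.
Qed.

(* The two cube relations give x x^(y^-1) x^y = 1 = x x^y x^(y^-1). *)
Lemma cubes_comm_conj x y : x ^+ 3 = 1 -> y ^+ 3 = 1 -> (x * y) ^+ 3 = 1 -> (x * y^-1) ^+
  3 = 1 ->
  commute x (x ^ y).
Proof.
move=> x3 y3 xy3 xyV3; have yy := invg_expg3 y3.
have yVyV : y^-1 * y^-1 = y by rewrite -invMg yy invgK.
pose a := x ^ y^-1; pose b := x ^ y.
have ab : a * b = x^-1.
  apply/eqP; rewrite eq_sym eq_invg_mul -xy3 expg3E /a /b !conjgE invgK !mulgA.
  by rewrite -(mulgA _ y^-1 y^-1) yVyV.
have ba : b * a = x^-1.
  apply/eqP; rewrite eq_sym eq_invg_mul -xyV3 expg3E /a /b !conjgE invgK !mulgA.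
  by rewrite -(mulgA _ y y) yy.
have: commute b (a * b) by rewrite /commute mulgA ba ab.
by rewrite ab -{2}[x]invgK => /commuteV/commute_sym.
Qed.

(* Otherwise x and y generate a Heisenberg group with center <c>. In the
   representation where c is a primitive cube root of unity, the vector fixed by y
   is killed by T^2 - 2 T - 2 for T = x + x^-1 + y + y^-1. *)
Lemma class_cubes_commute x y : x \in G -> y \in G ->
  x ^+ 3 = 1 -> y ^+ 3 = 1 -> (x * y) ^+ 3 = 1 -> (x * y^-1) ^+ 3 = 1 -> commute x y.
Proof.
move=> Gx Gy x3 y3 xy3 xyV3; pose c := [~ x, y].
have cxxy := cubes_comm_conj x3 y3 xy3 xyV3.
have ccx : commute c x.
  by rewrite /c commgEl; apply/commute_sym/commuteM => //; apply/commuteV.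
have ccy : commute c y.
  have cyyx : commute y (y ^ x).
    apply: cubes_comm_conj => //.
      by rewrite (_ : y * x = (x * y) ^ x) ?conjgE;
        [rewrite -conjgE -conjXg xy3 conj1g | group_nf].
    have -> : y * x^-1 = (x * y^-1)^-1 by rewrite invMg invgK.
    by rewrite expgVn xyV3 invg1.
  rewrite /c -invg_comm; apply/commute_sym/commuteV; rewrite commgEl.
  by apply/commuteM => //; apply/commuteV.
have c3 : c ^+ 3 = 1.
  rewrite /c commgEl expgMn; last by apply/commute_sym/commuteV/commute_sym.
  by rewrite expgVn -conjXg x3 conj1g invg1 mulg1.
apply/eqP; apply: contraT => ncxy; have nc : ~ commute x y by move/eqP;
  rewrite (negPf ncxy).
have c1 : c != 1 by apply: contraNN ncxy => /commgP/eqP.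
have Gc : c \in G by rewrite groupR.
have y1 : y != 1 by apply: contraNN ncxy => /eqP->; rewrite mulg1 mul1g.
have iyc : indep3 y c.
  split=> //; split=> //; apply/eqP=> Dc; case: nc; [rewrite -Dc | rewrite -[y]invgK -Dc];
    first exact/commute_sym.
  by apply/commuteV/commute_sym.
have yV : y ^+ 2 != 1.
  by apply: contraNneq y1 => y2; rewrite -y3 expgSr y2 mul1g.
have xV : x ^+ 2 != 1.
  by apply: contraNneq ncxy => x2; rewrite -[x]mul1g -x2 -expgSr x3 mul1g mulg1.
pose V := split3 G y c.
have Vy : (V * U y = V)%R := split3_fix Gy Gc iyc.
have VyV : (V * U y^-1 = V)%R := split3_fixV Gy Gc iyc.
have Vc : (V * U c + V * U c^-1 = - V)%R := split3_move Gy Gc iyc.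
have fy w : (V * U (y * w)%g = V * U w)%R by apply: regmx_fix.
have fyV w : (V * U (y^-1 * w)%g = V * U w)%R by apply: regmx_fix; rewrite ?groupV.
have Vcw w : (V * U (c * w)%g = - (V * U w) - V * U (c^-1 * w)%g)%R.
  have := congr1 (fun M => M * U w)%R Vc.
  rewrite mulrDl mulNr -!GRing.mulrA -!regmxM ?groupV // => <-.
  by rewrite addrK.
have xx := invg_expg3 x3; have yy := invg_expg3 y3.
have xVxV : x^-1 * x^-1 = x by rewrite -invMg xx invgK.
have yVyV : y^-1 * y^-1 = y by rewrite -invMg yy invgK.
have ccVx : commute c^-1 x by apply/commute_sym/commuteV/commute_sym.
have Exy : x * y = y * (c * x) by rewrite ccx /c commgEl conjgE; group_nf.
clearbody c; have ExyV : x * y^-1 = y^-1 * (c^-1 * x).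
  apply: (mulgI y); rewrite mulKVg; apply: (mulIg y); rewrite mulgA mulgKV.
  by rewrite ccVx -mulgA (_ : c^-1 * y = y * c^-1) 1?mulgA ?Exy;
    [rewrite ccx mulgA mulgK | apply/commute_sym/commuteV/commute_sym].
have ExVy : x^-1 * y = y * (c^-1 * x^-1).
  apply: (mulgI x); rewrite mulKVg mulgA Exy -!mulgA.
  by rewrite (mulgA x c^-1) -ccVx mulgK mulgV mulg1.
have ExVyV : x^-1 * y^-1 = y^-1 * (c * x^-1).
  apply: invg_inj; rewrite !invMg !invgK.
  have cVy : c^-1 * y = y * c^-1 by apply/commute_sym/commuteV/commute_sym.
  by rewrite -mulgA cVy mulgA Exy ccx mulgA mulgK.
exfalso.
apply: (@in_class_words _ _ _ [:: x; x^-1; y; y^-1] V 2 2 G4) => //.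
- exact: no_int_root_2_2.
- do 2?[apply: conn_seq_pair => //]; rewrite !inE negb_or.
  by apply/andP; split; apply/eqP=> Dx; case: nc; rewrite Dx //; apply/commute_sym/commuteV.
- exact: split3_coef.
rewrite !big_cons !big_nil !mulgV !mulVg xx yy xVxV yVyV Exy ExyV ExVy ExVyV.
rewrite !fy !fyV !Vcw Vy VyV regmx1 !GRing.mulr1; mx_linear.
Qed.

End Class4.

(** * Elementary relations for elements of order 2 and 3 *)

Section Elements.

Variable gT : finGroupType.
Implicit Types g h s t u w x y : gT.

Lemma expg23_1 x : x ^+ 2 = 1 -> x ^+ 3 = 1 -> x = 1.
Proof. by move=> x2; rewrite expgS x2 mulg1. Qed.

Lemma expg2_neq1 x : x ^+ 3 = 1 -> x != 1 -> x ^+ 2 != 1.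
Proof. by move=> x3; apply: contraNneq => x2; rewrite (expg23_1 x2 x3). Qed.

Lemma mulg_invol_conj x t : t ^+ 2 = 1 -> t * x = x ^ t * t.
Proof. by move=> t2; rewrite conjgE (invg_expg2 t2) -!mulgA -expg2E t2 mulg1. Qed.

Lemma involutions_commute s t : s ^+ 2 = 1 -> t ^+ 2 = 1 -> (s * t) ^+ 2 = 1 -> commute s t.
Proof.
move=> s2 t2 st2; have := invg_expg2 st2.
by rewrite invMg (invg_expg2 s2) (invg_expg2 t2).
Qed.

Lemma conj_fix_commute x t : x ^ t = x -> commute x t.
Proof. by move=> E; rewrite /commute conjgC E. Qed.

Lemma commute_conj_fix x t : commute x t -> x ^ t = x.
Proof. by move=> c; rewrite conjgE c mulKg. Qed.

Lemma invol_mul_inverted t x : t ^+ 2 = 1 -> x ^ t = x^-1 -> (x * t) ^+ 2 = 1.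
Proof.
by move=> t2 xt; rewrite expg2E mulgA -(mulgA x) (mulg_invol_conj x t2) xt mulKVg -expg2E.
Qed.

Lemma fixed_inverted3 x t : x ^+ 3 = 1 -> x ^ t = x -> x ^ t = x^-1 -> x = 1.
Proof.
move=> x3 E; rewrite E => xV; apply: expg23_1 => //.
by rewrite expg2E {2}xV mulgV.
Qed.

Lemma commute_conj x y z : commute x y -> commute (x ^ z) (y ^ z).
Proof. by move=> c; rewrite /commute -!conjMg c. Qed.

End Elements.

(** * Excluded configurations of elements of orders 2, 3 and 4 *)

Section Class4.

Variables (gT : finGroupType) (G : {group gT}).
Hypothesis G4 : in_class 4 G.
Implicit Types (g h s t u w x y : gT) (V : 'M[algC]_#|G|) (Q : {group gT}).
Notation U := (regmx G).

(* In the two-dimensional representation where x = diag(1, w), x^t = diag(w, 1) for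
   a primitive cube root of unity w, T = x + x^-1 + t satisfies T^2 = T + 3. *)
Lemma class_no_S3xZ3 x t : x \in G -> t \in G -> x ^+ 3 = 1 -> t ^+ 2 = 1 ->
  commute x (x ^ t) -> x ^ t != x -> x ^ t != x^-1 -> False.
Proof.
move=> Gx Gt x3 t2 cxy yx yxV; pose y := x ^ t.
have Gy : y \in G by rewrite groupJ.
have x1 : x != 1 by apply: contraNneq yx => ->; rewrite conj1g.
have ixy : indep3 x y.
  split=> //; first by rewrite -conjXg x3 conj1g.
  by split=> //; rewrite -(conj1g t) (inj_eq (conjg_inj t)).
have x2 := expg2_neq1 x3 x1.
pose V := split3 G x y.
have Vx : (V * U x = V)%R := split3_fix Gx Gy ixy.
have VxV : (V * U x^-1 = V)%R := split3_fixV Gx Gy ixy.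
have Vy : (V * U y + V * U y^-1 = - V)%R := split3_move Gx Gy ixy.
have Etx : t * x = y * t := mulg_invol_conj x t2.
have EtxV : t * x^-1 = y^-1 * t by rewrite /y -conjVg; apply: mulg_invol_conj.
have Vyt : (V * U (y * t)%g = - (V * U t) - V * U (y^-1 * t)%g)%R.
  have := congr1 (fun M => M * U t)%R Vy.
  rewrite mulrDl mulNr -!GRing.mulrA -!regmxM ?groupV // => <-.
  by rewrite addrK.
apply: (@in_class_words _ _ _ [:: x; x^-1; t] V 1 3 G4) => //.
- exact: no_int_root_1_3.
- apply: conn_seq_pair => //; last by rewrite inE; apply: contraNneq yx => <-;
  rewrite conjgE mulKg.
  by apply: conn_seq_invol => //; apply: contraNneq yx => ->; rewrite conjg1.
- exact: split3_coef.
rewrite !big_cons !big_nil mulgV mulVg (invg_expg3 x3) -invMg (invg_expg3 x3) invgK.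
rewrite (regmx_fix t Gx Vx) (regmx_fix t _ VxV) ?groupV // Etx EtxV Vyt -expg2E t2 regmx1.
rewrite VxV Vx GRing.mulr1; mx_linear.
Qed.

(* Where w = 1 and x is a primitive cube root of unity, the square of
   (1 + x + w) t is (2 + x)(2 + x^-1) = 3. *)
Lemma class_no_E9_inverted t x w : t \in G -> x \in G -> w \in G -> t ^+ 2 = 1 ->
  indep3 w x -> x ^ t = x^-1 -> w ^ t = w^-1 -> False.
Proof.
move=> Gt Gx Gw t2 iwx xt wt; have [w3 x3 cwx w1 [x1 xw xwV]] := iwx.
have Etx : t * x = x^-1 * t by rewrite -xt; apply: mulg_invol_conj.
have Etw : t * w = w^-1 * t by rewrite -wt; apply: mulg_invol_conj.
have tt : t * t = 1 by rewrite -expg2E.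
have ng g : g ^+ 3 = 1 -> g != 1 -> g ^ t = g^-1 -> t != g.
  by move=> g3 g1 gt; apply: contraNneq g1 => Dt; apply/eqP/(fixed_inverted3 g3 _ gt);
    rewrite Dt conjgE mulKg.
have gt1 g : g ^+ 3 = 1 -> g != 1 -> g ^ t = g^-1 -> g * t != 1.
  move=> g3 g1 gt; apply: contra (ng _ g3 g1 gt) => /eqP/mulg1_eq Dt.
  by rewrite -[g]invgK Dt (invg_expg2 t2).
pose V := split3 G w x.
have Vw : (V * U w = V)%R := split3_fix Gw Gx iwx.
have VwV : (V * U w^-1 = V)%R := split3_fixV Gw Gx iwx.
have Vx : (V * U x + V * U x^-1 = - V)%R := split3_move Gw Gx iwx.
have {}Vx : (V * U x = - V - V * U x^-1)%R by rewrite -Vx addrK.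
have t1 : t != 1.
  by apply: contraNneq x1 => t1; apply/eqP/(fixed_inverted3 x3 _ xt); rewrite t1 conjg1.
apply: (@in_class_words _ _ _ [:: t; x * t; w * t] V 0%R 3 G4) => //.
- exact: no_int_root_3.
- apply: conn_seq_invol => //; last first.
    rewrite !inE negb_or -{1}[t]mul1g -{3}[t]mul1g !(inj_eq (mulIg t)) ![1 == _]eq_sym.
    by rewrite x1 w1.
  apply: conn_seq_invol; rewrite ?groupM ?gt1 ?invol_mul_inverted //; last first.
    by rewrite inE (inj_eq (mulIg t)).
  by apply: conn_seq_invol; rewrite ?groupM ?gt1 ?invol_mul_inverted.
- exact: split3_coef.
rewrite !big_cons !big_nil -!mulgA tt mulg1 (mulgA t x) (mulgA t w) Etx Etw -!mulgA tt
  !mulg1.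
rewrite !mulgV regmx1 GRing.mulr1 (regmx_fix x^-1 Gw Vw).
have -> : x * w^-1 = w^-1 * x by apply/commute_sym/commute_sym/commuteV/commute_sym.
rewrite (regmx_fix x _ VwV) ?groupV // Vx Vw VwV; mx_linear.
Qed.

(* Otherwise x permutes the three conjugates t, s, r of t. The vector on which
   t = s = -1 and r = 1 is killed by T^2 + T - 4 for T = x + x^-1 + t + s. *)
Lemma class_no_A4 x t : x \in G -> t \in G -> x ^+ 3 = 1 -> t ^+ 2 = 1 ->
  commute t (t ^ x) -> t ^ x = t.
Proof.
move=> Gx Gt x3 t2; move Ds: (t ^ x) => s; move Er: (t ^ x^-1) => r c01.
apply/eqP; apply: contraT => nst; exfalso.
have [Gs Gr] : s \in G /\ r \in G by rewrite -Ds -Er !groupJ ?groupV.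
have xx := invg_expg3 x3; have xVxV : x^-1 * x^-1 = x by rewrite -invMg xx invgK.
have s2 : s ^+ 2 = 1 by rewrite -Ds -conjXg t2 conj1g.
have r2 : r ^+ 2 = 1 by rewrite -Er -conjXg t2 conj1g.
have sx : s ^ x = r by rewrite -Ds -Er -conjgM xx.
have rx : r ^ x = t by rewrite -Er conjgKV.
have csr : commute s r by rewrite -sx -{1}Ds; apply: commute_conj.
have crt : commute r t by rewrite -rx -sx; apply/commute_conj; rewrite sx.
have cts : commute t s by [].
(* [z] may or may not be trivial. Imposing [z = 1] in [V] makes [r = s t z] act as 1 where
   [t = s = -1]. *)
move Dz: (t * s * r) => z.
have Gz : z \in G by rewrite -Dz !groupM.
have z2 : z ^+ 2 = 1.
  rewrite -Dz !expgMn ?t2 ?s2 ?r2 ?mulg1 //.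
  by apply/commute_sym/commuteM => //; apply/commute_sym.
have czt : commute z t.
  rewrite -Dz; apply/commute_sym/commuteM; last exact/commute_sym.
  exact: commuteM.
have czs : commute z s.
  by rewrite -Dz; apply/commute_sym/commuteM => //; apply/commuteM => //; apply/commute_sym.
have tV := invg_expg2 t2; have sV := invg_expg2 s2.
have t1 : t != 1 by apply: contraNneq nst => t1; rewrite -Ds t1 conj1g.
have s1 : s != 1 by rewrite -Ds -(conj1g x) (inj_eq (conjg_inj x)).
have r1 : r != 1 by rewrite -Er -(conj1g x^-1) (inj_eq (conjg_inj x^-1)).
have rs : r != s by rewrite -sx -{2}Ds (inj_eq (conjg_inj x)).
have tr : t != r by rewrite -rx -sx (inj_eq (conjg_inj x)) sx.
pose V := ((1 + U z) * (1 - U t) * (1 - U s))%R.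
have Vs : (V * U s = - V)%R by rewrite /V -GRing.mulrA opp_part // GRing.mulrN.
have Vt : (V * U t = - V)%R.
  apply: etrans (mul_part_act (e := (- ((1 + U z) * (1 - U t)))%R) _ _) _.
  - by apply: opp_part_comm => //; apply/commute_sym.
  - by rewrite -GRing.mulrA opp_part // GRing.mulrN.
  by rewrite mulNr.
have Vz : (V * U z = V)%R.
  apply: mul_part_act; first by apply: opp_part_comm => //; apply/commute_sym.
  apply: mul_part_act; first by apply: opp_part_comm => //; apply/commute_sym.
  by rewrite sym_part.
have Dr : r = s * (t * z).
  by rewrite -Dz -(mulgA t) (mulgA t t) -expg2E t2 mul1g mulgA -expg2E s2 mul1g.
have ft w : (V * U (t * w)%g = - (V * U w))%R by apply: regmx_opp.
have fs w : (V * U (s * w)%g = - (V * U w))%R by apply: regmx_opp.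
have Vr : (V * U r = V)%R by rewrite Dr fs ft Vz opprK.
have fr w : (V * U (r * w)%g = V * U w)%R by apply: regmx_fix.
have Ext : x * t = r * x by rewrite -Er conjgE; group_nf.
have Exs : x * s = t * x by rewrite -Ds conjgE; group_nf.
have ExVt : x^-1 * t = s * x^-1 by rewrite -Ds conjgE; group_nf.
have ExVs : x^-1 * s = r * x^-1 by rewrite -sx conjgE; group_nf.
apply: (@in_class_words _ _ _ [:: x; x^-1; t; s] V (-1)%R 4 G4) => //.
- exact: no_int_root_N1_4.
- apply: conn_seq_pair => //.
  + apply: conn_seq_invol => //; last by rewrite inE eq_sym.
    exact: conn_seq_invol.
  + by apply: expg2_neq1 => //; apply: contraNneq nst => x1; rewrite -Ds x1 conjg1.
  rewrite !inE negb_or; apply/andP; split; apply: contraNneq nst => Dx.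
    by rewrite -Ds Dx conjgE mulKg.
  have : x ^+ 2 = 1 by rewrite Dx.
  by move/expg23_1=> /(_ x3) x1; rewrite -Ds x1 conjg1.
- rewrite /V; ring_expand; rewrite -!regmxM ?groupM // !coef_oneE.
  have -> : (z * t == 1) = false.
    by rewrite (eq_mulg1_invol t z2) -Dz -{1}[t]mulg1 -mulgA (inj_eq (mulgI t)) eq_sym
      -eq_invg_mul sV eq_sym (negPf rs).
  have -> : (z * s == 1) = false.
    rewrite (eq_mulg1_invol s z2) -Dz cts -{1}[s]mulg1 -mulgA (inj_eq (mulgI s)) eq_sym
      -eq_invg_mul tV.
    exact: negPf.
  have -> : (z * t * s == 1) = false.
    by rewrite -mulgA (eq_mulg1_invol _ z2) -Dz -{1}[t * s]mulg1 (inj_eq (mulgI _)) eq_sym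
      (negPf r1).
  have -> : (t * s == 1) = false by rewrite -eq_invg_mul tV eq_sym (negPf nst).
  rewrite (negPf t1) (negPf s1); coef_simp; rewrite ?opprK; coef_simp.
  exact: add1_nat_neq0.
rewrite !big_cons !big_nil mulgV mulVg xx xVxV Ext Exs ExVt ExVs -[t * t]expg2E t2 -[s *
  s]expg2E s2.
rewrite !ft !fs !fr Vt Vs regmx1 GRing.mulr1; mx_linear.
Qed.

(** The product [t t^x] has square or cube 1. In the first case [t] and [t^x] commute and
    [class_no_A4] gives [t^x = t]. In the second case, with [y = x^t], the element [x y^-1] is
    conjugate to [t t^x] and has cube 1, and [(x t)^2 = x y]. *)
Lemma class_invol_normalizes t x : t \in G -> x \in G -> t ^+ 2 = 1 -> x ^+ 3 = 1 ->
  x ^ t = x \/ x ^ t = x^-1.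
Proof.
move=> Gt Gx t2 x3.
have commI s : s \in G -> s ^+ 2 = 1 -> (s * s ^ x) ^+ 2 = 1 -> commute x s.
  move=> Gs s2 ss2; apply/commute_sym/conj_fix_commute/class_no_A4 => //.
  by apply: involutions_commute; rewrite // -conjXg s2 conj1g.
have tx2 : (t ^ x) ^+ 2 = 1 by rewrite -conjXg t2 conj1g.
case: (class_mul_involution G4 Gt (groupJ Gt Gx) t2 tx2) => [u2 | u3].
  by left; apply/commute_conj_fix/commI.
pose y := x ^ t; have Gy : y \in G by rewrite groupJ.
have [|yx] := eqVneq (x ^ t) x; first by left.
have [|yxV] := eqVneq (x ^ t) x^-1; first by right.
have y3 : y ^+ 3 = 1 by rewrite -conjXg x3 conj1g.
have tV := invg_expg2 t2.
have Exy : x * y = (x * t) ^+ 2 by rewrite expg2E /y conjgE tV !mulgA.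
have xyV3 : (x * y^-1) ^+ 3 = 1.
  have -> : x * y^-1 = (t * t ^ x) ^ x^-1 by rewrite /y !conjgE; group_nf; rewrite tV.
  by rewrite -conjXg u3 conj1g.
(* If [(x t)^6 = 1], then [(x y)^3 = 1], so [x] and [y] commute and [class_no_S3xZ3] applies. If
   [(x t)^4 = 1], then [s = x y] has square 1, and [s^3 = 1] would give [y = x^-1]. *)
exfalso; have [xt4|xt6] := class_order G4 (groupM Gx Gt); last first.
  apply: (class_no_S3xZ3 Gx Gt x3 t2 _ yx yxV).
  by apply: (class_cubes_commute G4) => //; rewrite Exy -expgM.
pose s := x * y; have s2 : s ^+ 2 = 1 by rewrite /s Exy -expgM.
have Gs : s \in G by rewrite groupM.
have sx2 : (s ^ x) ^+ 2 = 1 by rewrite -conjXg s2 conj1g.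
suff s3 : s ^+ 3 = 1.
  by case/eqP: yxV; have := expg23_1 s2 s3 => /mulg1_eq.
case: (class_mul_involution G4 Gs (groupJ Gs Gx) s2 sx2) => [ss2 | ss3].
  have cxy : commute x y by have /commI := Gs => /(_ s2 ss2);
    rewrite /s /commute -mulgA => /mulgI.
  by rewrite /s expgMn // x3 y3 mulg1.
(* Because [x] and [y] have cube 1, [s^-1] is conjugate to [s s^x] and has cube 1 as well. *)
have Es : s^-1 = (s * s ^ x) ^ x.
  have aux v : v ^+ 3 = 1 -> (x * v)^-1 = (x * v * (x * v) ^ x) ^ x.
    move=> v3; rewrite !conjgE; group_nf.
    by rewrite (invg_expg3 v3) -mulgA (invg_expg3 x3).
  exact: aux.
by rewrite -(invg_expg2 s2) Es -conjXg ss3 conj1g.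
Qed.

(** The element [s = x w] of square 1 centralizes or inverts [x]. In the first case [w = x^-1 s]
    yields [s^3 = w^3 = 1]. In the second case [w^2 = 1], so [w = 1] and [s = x]. *)
Lemma class_mul_cubes_expg2 x w : x \in G -> w \in G -> x ^+ 3 = 1 -> w ^+ 3 = 1 ->
  (x * w) ^+ 2 = 1 -> x * w = 1.
Proof.
move=> Gx Gw x3 w3; move Ds: (x * w) => s s2.
have Gs : s \in G by rewrite -Ds groupM.
have Dw : w = x^-1 * s by rewrite -Ds mulKg.
have [xs | xs] := class_invol_normalizes Gs Gx s2 x3.
  have csx : commute x^-1 s by apply/commute_sym/commuteV/commute_sym/conj_fix_commute.
  by apply: (expg23_1 s2); rewrite -w3 Dw (expgMn 3 csx) expgVn x3 invg1 mul1g.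
have w1 : w = 1.
  apply: expg23_1 w3; rewrite Dw; apply: invol_mul_inverted => //.
  by rewrite conjVg xs.
by apply: (expg23_1 s2); rewrite -Ds w1 mulg1.
Qed.

(* The hypotheses make <u, x> a copy of SL(2, 3). In the representation of degree 3
   of its quotient A4, the vector on which u = 1 and u^x = -1 is killed by
   T^2 - T - 4 for T = x + x^-1 + u + u^-1. *)
Lemma class_no_SL23 x u : x \in G -> u \in G -> x ^+ 3 = 1 -> u ^+ 4 = 1 -> u ^+ 2 != 1 ->
  commute (u * u) x -> u * u ^ x * u ^ x^-1 = 1 -> False.
Proof.
move=> Gx Gu x3 u4; rewrite expg2E.
move Dt: (u * u) => t; move Dk: (u ^ x) => k; move Dm: (u ^ x^-1) => m t1 ctx ukm.
have [Gk Gm Gt] : [/\ k \in G, m \in G & t \in G].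
  by rewrite -Dk -Dm -Dt !groupJ ?groupM ?groupV.
have xx := invg_expg3 x3; have xVxV : x^-1 * x^-1 = x by rewrite -invMg xx invgK.
have tt : t * t = 1 by rewrite -Dt -!expg2E -expgM.
have tV : t^-1 = t := invg_expg2 tt.
have ctu : commute t u by rewrite /commute -Dt mulgA.
have kk : k * k = t by rewrite -Dk -conjMg Dt commute_conj_fix.
have mm : m * m = t by rewrite -Dm -conjMg Dt commute_conj_fix //; apply: commuteV.
have ctk : commute t k by rewrite /commute -kk mulgA.
have uV : u^-1 = t * u by apply: (mulgI u); rewrite mulgV mulgA -ctu -mulgA Dt tt.
have kV : k^-1 = t * k by apply: (mulgI k); rewrite mulgV mulgA -ctk -mulgA kk tt.
have mV : m^-1 = u * k by rewrite -(mulg1_eq ukm) invgK.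
have ukuk : u * k * (u * k) = t by rewrite -mV -invMg mm.
have ku : k * u = t * (u * k).
  have -> : k * u = u^-1 * (u * k * (u * k)) * k^-1 by group_nf.
  by rewrite ukuk uV kV -!mulgA (mulgA t t) tt mul1g.
have uk : u * k = t * (k * u) by rewrite ku mulgA tt mul1g.
have u1 : u != 1 by apply: contraNneq t1 => u1; rewrite -Dt u1 mulg1.
have k1 : k != 1 by apply: contraNneq t1 => k1; rewrite -kk k1 mulg1.
have uk1 : u * k != 1 by apply: contraNneq t1 => uk1; rewrite -ukuk uk1 mulg1.
have x1 : x != 1.
  apply: contraNneq u1 => x1; move: ukm; rewrite -Dk -Dm x1 invg1 !conjg1 Dt -uV.
  by move/eqP; rewrite eq_invg1.
(* Once [t = 1], the actions of [u] and [k] commute; [u = 1] and [k = -1] then force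
   [m = (u k)^-1 = -1]. *)
pose W := ((1 + U t) * (1 - U k))%R; pose V := (W * (1 + U u))%R.
have Wt : (W * U t = W)%R.
  apply: mul_part_act; last by rewrite sym_part.
  by apply: opp_part_comm => //; apply/commute_sym.
have Wk : (W * U k = - W)%R.
  have UtUt : (U t * U t = 1)%R by rewrite -regmxM // tt regmx1.
  rewrite /W -GRing.mulrA mulrBl -regmxM // kk.
  by ring_expand; rewrite UtUt; mx_linear.
have VW : V = (W + W * U u)%R by rewrite /V mulrDr GRing.mulr1.
have Vt : (V * U t = V)%R.
  by apply: mul_part_act => //; apply: sym_part_comm => //; apply/commute_sym.
have Vu : (V * U u = V)%R by rewrite VW mulrDl -GRing.mulrA -regmxM // Dt Wt GRing.addrC.
have Vk : (V * U k = - V)%R.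
  rewrite VW mulrDl Wk -GRing.mulrA -regmxM // uk (regmx_fix _ Gt Wt) (regmx_opp _ Gk Wk).
  by rewrite opprD.
have ft w : (V * U (t * w)%g = V * U w)%R by apply: regmx_fix.
have fu w : (V * U (u * w)%g = V * U w)%R by apply: regmx_fix.
have fk w : (V * U (k * w)%g = - (V * U w))%R by apply: regmx_opp.
have fm w : (V * U (m * w)%g = - (V * U w))%R.
  by rewrite -[in RHS](mulKg m w) mV -mulgA fu fk opprK.
have Exu : x * u = m * x by rewrite -Dm conjgE; group_nf.
have ExVu : x^-1 * u = k * x^-1 by rewrite -Dk conjgE; group_nf.
have ctxV : commute t x^-1 by apply: commuteV.
have kNu : k != u by apply: contraNneq t1 => E; move: ku; rewrite E Dt tt => ->.
exfalso; apply: (@in_class_words _ _ _ [:: x; x^-1; u; u^-1] V 1 4 G4) => //.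
- exact: no_int_root_1_4.
- apply: conn_seq_pair => //; [|exact: expg2_neq1|]; first by apply: conn_seq_pair;
  rewrite // expg2E Dt.
  rewrite !inE negb_or; apply/andP; split; apply: contraNneq kNu => Dx;
    rewrite -Dk Dx conjgE.
    by rewrite mulKg.
  by rewrite mulgV mulg1 invgK.
- rewrite VW /W; ring_expand; rewrite -!regmxM ?groupM // !coef_oneE -kV -uV.
  rewrite -(eq_invg_mul k^-1) invgK !eq_invg1 (negPf k1) (negPf u1) (negPf t1) (negPf kNu).
  have -> : (k * u == 1) = false.
    by rewrite -eq_invg_mul; apply: contraNF uk1 => /eqP <-; rewrite mulVg.
  by coef_simp; rewrite oner_eq0.
have EuVuV : u^-1 * u^-1 = t by rewrite -invMg Dt.
have ExuV : x * u^-1 = t * (m * x) by rewrite uV mulgA -ctx -mulgA Exu.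
have ExVuV : x^-1 * u^-1 = t * (k * x^-1) by rewrite uV mulgA -ctxV -mulgA ExVu.
have EuV w : u^-1 * w = t * (u * w) by rewrite uV mulgA.
rewrite !big_cons !big_nil !mulgV !mulVg xx xVxV Dt EuVuV Exu ExVu ExuV ExVuV !EuV uV.
rewrite !(ft, fu, fk, fm) Vt Vu regmx1 GRing.mulr1; mx_linear.
Qed.

(* Where g^2 = 1, r = -1 and x is a primitive cube root of unity, the square of
   2 (1 - x) g is 4 (1 - x)(1 - x^-1) = 12. *)
Lemma class_no_Dic12xZ2 x g r : x \in G -> g \in G -> r \in G ->
  x ^+ 3 = 1 -> x != 1 -> g ^+ 4 = 1 -> g ^+ 2 != 1 -> x ^ g = x^-1 ->
  r ^+ 2 = 1 -> commute r x -> commute r g -> r != 1 -> r != g ^+ 2 -> False.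
Proof.
move=> Gx Gg Gr x3 x1 g4; rewrite expg2E; move Dt: (g * g) => t t1 xg r2 crx crg r1 rt.
(* On [V] this acts as [- x g], and [h^2 = g^2], so the sum over [{g, g^-1, h, h^-1}] acts as
   [2 (1 - x) g]. *)
move Dh: (r * (x * g)) => h.
have [Gt Gh] : t \in G /\ h \in G by rewrite -Dt -Dh !groupM.
have x2 := expg2_neq1 x3 x1.
have tt : t * t = 1 by rewrite -Dt -!expg2E -expgM.
have rr : r * r = 1 by rewrite -expg2E.
have gx : g * x = x^-1 * g by have := conjgC x^-1 g; rewrite conjVg xg invgK => ->.
have xgE : x * g = g * x^-1 by rewrite conjgC xg.
have ctx : commute t x by rewrite /commute -Dt -mulgA gx mulgA -xgE mulgA.
have ctg : commute t g by rewrite /commute -Dt mulgA.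
have ctr : commute t r by rewrite -Dt; apply/commute_sym/commuteM.
have cth : commute t h by rewrite -Dh; apply: commuteM => //; apply: commuteM.
have hh : h * h = t.
  rewrite -Dh -!mulgA (mulgA g r) -crg -!mulgA (mulgA x r) -crx -!mulgA (mulgA r r) rr
    mul1g.
  by rewrite (mulgA g x) gx -!mulgA mulKVg.
have gV : g^-1 = t * g by apply: (mulgI g); rewrite mulgV mulgA -ctg -mulgA Dt tt.
have hV : h^-1 = t * h by apply: (mulgI h); rewrite mulgV mulgA -cth -mulgA hh tt.
pose W := ((1 + U t) * (1 - U r))%R; pose V := (W * (1 + 1 - U x - U x^-1))%R.
have Wt : (W * U t = W)%R.
  apply: mul_part_act; last by rewrite sym_part.
  by apply: opp_part_comm => //; apply/commute_sym.
have Wr : (W * U r = - W)%R by rewrite /W -GRing.mulrA opp_part // GRing.mulrN.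
have Vt : (V * U t = V)%R.
  by apply: mul_part_act => //; apply: move3_part_comm => //; apply/commute_sym.
have Vr : (V * U r = - V)%R.
  apply: etrans (mul_part_act _ Wr) _; last by rewrite mulNr.
  by apply: move3_part_comm => //; apply/commute_sym.
have Vx : (V * U x + V * U x^-1 = - V)%R.
  by rewrite /V -!(GRing.mulrA W) -mulrDr move3_part // GRing.mulrN.
have {}Vx : (V * U x = - V - V * U x^-1)%R by rewrite -Vx addrK.
have ft w : (V * U (t * w)%g = V * U w)%R by apply: regmx_fix.
have fr w : (V * U (r * w)%g = - (V * U w))%R by apply: regmx_opp.
have gVl w : g^-1 * w = t * (g * w) by rewrite gV mulgA.
have hVl w : h^-1 * w = t * (h * w) by rewrite hV mulgA.
have gVr w : commute t w -> w * g^-1 = t * (w * g) by move=> ctw;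
  rewrite gV mulgA -ctw mulgA.
have hVr w : commute t w -> w * h^-1 = t * (w * h) by move=> ctw;
  rewrite hV mulgA -ctw mulgA.
have gh : g * h = t * (r * x^-1).
  rewrite -Dh mulgA -crg -mulgA (mulgA g) gx -mulgA Dt [RHS]mulgA ctr -[RHS]mulgA.
  by congr (_ * _); apply: commute_sym (commuteV ctx).
have hg : h * g = t * (r * x) by rewrite -Dh -!mulgA Dt -ctx [RHS]mulgA ctr -[RHS]mulgA.
have nx p : p ^+ 2 = 1 -> (p * x == 1 = false) /\ (p * x^-1 == 1 = false).
  move=> p2; split; apply: contraNF x2 => /eqP/mulg1_eq E.
    by rewrite -E expgVn p2 invg1.
  by rewrite -[x]invgK -E expgVn expgVn p2 !invg1.
have t2 : t ^+ 2 = 1 by rewrite expg2E.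
have tr2 : (t * r) ^+ 2 = 1 by rewrite expgMn // t2 r2 mulg1.
have tr1 : t * r != 1 by rewrite (eq_mulg1_invol r t2).
apply: (@in_class_words _ _ _ [:: g; g^-1; h; h^-1] V 0%R 12 G4) => //.
- exact: no_int_root_12.
- apply: conn_seq_pair => //; last first.
  + rewrite !inE negb_or; apply/andP; split; apply/eqP=> Dg.
      have [/negbT/negP[]] := nx r r2; apply/eqP; apply: (mulIg g).
      by rewrite mul1g -mulgA Dh.
    have [/negbT/negP[]] := nx _ tr2; apply/eqP; apply: (mulIg g).
    by rewrite mul1g -!mulgA Dh [RHS]Dg hV.
  + by rewrite expg2E Dt.
  by apply: conn_seq_pair => //; rewrite expg2E hh.
- have [[E1 E2] [E3 E4] [E5 E6]] := And3 (nx t t2) (nx r r2) (nx _ tr2).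
  have [E7 E8] := nx 1 (expg1n _ 2); rewrite !mul1g in E7 E8.
  rewrite /V /W; ring_expand; rewrite -!regmxM ?groupM ?groupV // !coef_oneE.
  rewrite E1 E2 E3 E4 E5 E6 E7 E8 (negPf t1) (negPf r1) (negPf tr1); coef_simp.
  by rewrite -(natrD _ 1 1) pnatr_eq0.
rewrite !big_cons !big_nil !gVl !hVl (gVr h cth) (hVr g ctg) !mulgV Dt hh gh hg.
rewrite !(ft, fr) Vt Vx regmx1 GRing.mulr1; mx_linear.
Qed.

End Class4.

(* Where g^2 = 1, b = 1 and a is a primitive cube root of unity, the square of
   2 (1 + a + b) g is 4 (2 + a)(2 + a^-1) = 12. *)
Lemma dic_not_in_class6 (gT : finGroupType) (G : {group gT}) a b g :
  in_class 6 G -> a \in G -> b \in G -> g \in G -> indep3 b a ->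
  g ^+ 4 = 1 -> g ^+ 2 != 1 -> a ^ g = a^-1 -> b ^ g = b^-1 -> False.
Proof.
move=> G6 Ga Gb Gg iba g4; rewrite expg2E; move Dt: (g * g) => t t1 ag bg.
have [b3 a3 cba b1 [a1 ab abV]] := iba.
pose U := regmx G; pose V0 := split3 G b a; pose V := ((1 + U t) * V0)%R.
have Gt : t \in G by rewrite -Dt groupM.
have tt : t * t = 1 by rewrite -Dt -!expg2E -expgM.
have inv z : z ^ g = z^-1 -> g * z = z^-1 * g /\ commute t z.
  move=> zg; have gz : g * z = z^-1 * g by have := conjgC z^-1 g;
    rewrite conjVg zg invgK => ->.
  by split=> //; rewrite /commute -Dt -mulgA gz mulgA [RHS]mulgA (conjgC z g) zg.
have [[ga cta] [gb ctb]] := (inv a ag, inv b bg).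
have ctg : commute t g by rewrite /commute -Dt mulgA.
have ctV z : commute t z -> commute t z^-1 by apply: commuteV.
(* For [z] and [w] among [1], [a], [b] one has [(z g) (w g) = t z w^-1]; in particular all [z g]
   square to [t]. The connection set consists of [g], [a g], [b g] and their inverses. *)
pose h z := z * g.
have ct1 : commute t 1 by apply: commute1.
have g1 : g * 1 = 1^-1 * g by rewrite invg1 mulg1 mul1g.
have hh z w : commute t z -> commute t w -> g * w = w^-1 * g ->
    h z * h w = t * (z * w^-1).
  move=> ctz ctw gw; rewrite /h -mulgA (mulgA g) gw -!mulgA Dt -(ctV w ctw).
  by rewrite mulgA -ctz -mulgA.
have V0b : (V0 * U b = V0)%R := split3_fix Gb Ga iba.
have Vt : (V * U t = V)%R.
  have cV0 : GRing.comm V0 (U t).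
    apply/commr_sym/commrM.
      apply: commrD; last by apply: regmx_comm; rewrite ?groupV //; apply: ctV.
      by apply: commrD; [apply: commr1 | apply: regmx_comm].
    by apply/commr_sym/move3_part_comm => //; apply/commute_sym.
  by apply: mul_part_act => //; rewrite sym_part.
have Vb : (V * U b = V)%R by rewrite /V -GRing.mulrA V0b.
have VbV : (V * U b^-1%g = V)%R by rewrite /V -GRing.mulrA (split3_fixV Gb Ga iba).
have Va : (V * U a = - V - V * U a^-1%g)%R.
  have : (V * U a + V * U a^-1%g = - V)%R.
    by rewrite /V -!(GRing.mulrA _ V0) -mulrDr (split3_move Gb Ga iba) GRing.mulrN.
  by move <-; rewrite addrK.
have ft w : (V * U (t * w)%g = V * U w)%R by apply: regmx_fix.
have cth z : commute t z -> commute t (h z) by move=> ctz; apply: commuteM.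
have hV z : commute t z -> g * z = z^-1 * g -> (h z)^-1 = t * h z.
  move=> ctz gz; apply: (mulgI (h z)); rewrite mulgV mulgA -(cth z ctz) -mulgA.
  by rewrite (hh z z) // mulgV mulg1 tt.
have sw z w : commute t z -> h z * (t * h w) = t * (h z * h w).
  by move=> ctz; rewrite mulgA -(cth z ctz) -mulgA.
have nt p : p ^+ 3 = 1 -> (t * p == 1) = false.
  move=> p3; apply: contraNF t1 => /eqP/mulg1_eq Ep.
  have Dp : p = t by rewrite -Ep; apply: invg_expg2.
  by rewrite Dp in p3; rewrite (expg23_1 _ p3).
have hN z w : commute t w -> g * w = w^-1 * g -> z != w -> (w * z^-1) ^+ 3 = 1 ->
    h z \notin [:: h w; (h w)^-1].
  move=> ctw gw zw wz3; rewrite !inE negb_or /h (inj_eq (mulIg g)) zw /=.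
  rewrite -/(h w) hV // /h mulgA (inj_eq (mulIg g)) -(inj_eq (mulIg z^-1)) mulgV -mulgA.
  by rewrite eq_sym nt.
have h2 z : commute t z -> g * z = z^-1 * g -> h z ^+ 2 != 1.
  by move=> ctz gz; rewrite expg2E hh // mulgV mulg1.
have ba3 : (b * a^-1) ^+ 3 = 1.
  by rewrite expgMn ?expgVn ?a3 ?b3 ?invg1 ?mulg1 //; apply: commuteV.
have Gh z : z \in G -> h z \in G by move=> Gz; rewrite groupM.
apply: (@in_class_words _ _ _ [:: h 1; (h 1)^-1; h a; (h a)^-1; h b;
  (h b)^-1] V 0%R 12 G6) => //.
- exact: no_int_root_12.
- apply: conn_seq_pair; rewrite ?Gh ?h2 //; last first.
    rewrite -[[:: h a; _; _; _]]/([:: h a; (h a)^-1] ++ [:: h b; (h b)^-1]) mem_cat negb_or.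
    by rewrite !hN // ?invg1 ?mulg1 // eq_sym.
  apply: conn_seq_pair; rewrite ?Gh ?h2 ?hN //.
  by apply: conn_seq_pair; rewrite ?Gh ?h2.
- have -> : coef_one V = coef_one V0; last exact: split3_coef.
  rewrite /V mulrDl GRing.mul1r coef_oneD /V0 split3_expand //; ring_expand.
  have pw3 p q : p \in [:: b; b^-1] -> q \in [:: a; a^-1] -> (p * q) ^+ 3 = 1.
    rewrite !inE => /orP[]/eqP-> /orP[]/eqP->;
      rewrite expgMn ?expgVn ?a3 ?b3 ?invg1 ?mulg1 //.
    + exact: commuteV.
    + by apply/commute_sym/commuteV/commute_sym.
    by apply/commuteV/commute_sym/commuteV/commute_sym.
  rewrite -!regmxM // !coef_oneE (negPf t1) !nt ?pw3 ?expgVn ?a3 ?b3 ?invg1 ?inE ?eqxx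
    ?orbT //.
  by coef_simp.
clearbody h; rewrite !big_cons !big_nil !hV // -!mulgA !sw // !hh // !ft !invg1 !mul1g
  !mulg1 !mulgV.
have -> : a * b^-1 = b^-1 * a by apply: commuteV; apply: commute_sym.
rewrite (regmx_fix a^-1 Gb Vb) (regmx_fix a _ VbV) ?groupV // Va Vb VbV.
have -> : U 1 = 1%R by apply: regmx1.
rewrite GRing.mulr1; mx_linear.
Qed.

(** * Elements of order 4 invert elements of order 3 *)

Section Class4.

Variables (gT : finGroupType) (G : {group gT}).
Hypothesis G4 : in_class 4 G.
Implicit Types (g h s t u w x y : gT).

(** Put [t = y^2] and [w = x^y]. If [t] inverts [x], it inverts a group of order 9, which is
    excluded. Otherwise [t] centralizes [x]; then [w <> x^-1] implies [(x w)^3 = t], and both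
    [u^4 = 1] and [u^6 = 1] are impossible for [u = w^-1 x]. *)
Lemma class_order4_inverts y x : y \in G -> x \in G -> y ^+ 4 = 1 -> y ^+ 2 != 1 ->
  x ^+ 3 = 1 -> x ^ y = x^-1.
Proof.
move=> Gy Gx y4; rewrite expg2E; move Dt: (y * y) => t t1 x3.
have [-> | x1] := eqVneq x 1; first by rewrite conj1g invg1.
move Dw: (x ^ y) => w.
have [Gt Gw] : t \in G /\ w \in G by rewrite -Dt -Dw groupM ?groupJ.
have t2 : t ^+ 2 = 1 by rewrite -Dt -expg2E -expgM.
have tV := invg_expg2 t2.
have w3 : w ^+ 3 = 1 by rewrite -Dw -conjXg x3 conj1g.
have w1 : w != 1 by rewrite -Dw -(conj1g y) (inj_eq (conjg_inj y)).
have x2 := expg2_neq1 x3 x1.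
(* Otherwise [x] and [y] commute and [x y] has order 12. *)
have xw : x != w.
  apply: contraNneq t1 => Ew; have cxy : commute x y by apply: conj_fix_commute;
    rewrite Dw -Ew.
  have := class_order G4 (groupM Gx Gy); rewrite !expgMn // y4 mulg1.
  rewrite (expgM x 3 2) x3 expg1n mul1g (expgD y 4 2) y4 mul1g expg2E Dt (expgD x 3 1) x3
    mul1g expg1.
  by case=> [x1'|->] //; rewrite x1' eqxx in x1.
have cty : commute t y by rewrite /commute -Dt mulgA.
have Dwt : w ^ t = (x ^ t) ^ y by rewrite -Dw -!conjgM cty.
have [xt | xt] := class_invol_normalizes G4 Gt Gx t2 x3; last first.
  exfalso; have wt : w ^ t = w^-1 by rewrite Dwt xt conjVg Dw.
  have wVt : w^-1 ^ t = w^-1^-1 by rewrite conjVg wt.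
  have wxV : x != w^-1.
    apply: contraNneq x1 => Ex; apply/eqP/(fixed_inverted3 x3 _ xt).
    have Ew : w = x^-1 by rewrite Ex invgK.
    by rewrite -Dt conjgM Dw Ew conjVg Dw Ew invgK.
  (* [x v] is the product of [x t] and [v^-1 t], which both have square 1. *)
  have cubes v : v \in G -> v ^+ 3 = 1 -> v ^ t = v^-1 -> x != v^-1 -> (x * v) ^+ 3 = 1.
    move=> Gv v3 vt xvV; have vVt : v^-1 ^ t = v^-1^-1 by rewrite conjVg vt.
    have Exv : x * t * (v^-1 * t) = x * v.
      by rewrite -mulgA (mulgA t) (mulg_invol_conj _ t2) vVt invgK -mulgA -expg2E t2 mulg1.
    have Gxt : x * t \in G by rewrite groupM.
    have Gvt : v^-1 * t \in G by rewrite groupM ?groupV.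
    have [] := class_mul_involution G4 Gxt Gvt (invol_mul_inverted t2 xt)
      (invol_mul_inverted t2 vVt).
      rewrite Exv => /(class_mul_cubes_expg2 G4 Gx Gv x3 v3) Exv1.
      by rewrite -(mulg1_eq Exv1) invgK eqxx in xvV.
    by rewrite Exv.
  have cxw : commute x w.
    apply: (class_cubes_commute G4 Gx Gw x3 w3); first exact: cubes.
    by apply: cubes => //; rewrite ?groupV ?invgK // expgVn w3 invg1.
  by apply: (class_no_E9_inverted G4 Gt Gx Gw t2 _ xt wt).
apply/eqP; apply: contraT => wxV; exfalso.
have wt : w ^ t = w by rewrite Dwt xt Dw.
have wy : w ^ y = x by rewrite -Dw -conjgM Dt xt.
have ctx : commute t x by apply/commute_sym/conj_fix_commute.
have ctw : commute t w by apply/commute_sym/conj_fix_commute.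
have Exy : (x * y) ^+ 2 = x * w * t.
  have yx : y * x = w * y by rewrite (conjgC w y) wy.
  by rewrite expg2E -mulgA (mulgA y) yx -Dt !mulgA.
have ctxw : commute (x * w) t by apply/commute_sym/commuteM.
(* If [(x y)^4 = 1], then [(x w)^2 = 1], hence [w = x^-1], which was excluded. So [(x y)^6 = 1],
   that is [(x w t)^3 = 1]. *)
have xw3 : (x * w) ^+ 3 = t.
  have [xy4 | xy6] := class_order G4 (groupM Gx Gy).
    have : (x * w * t) ^+ 2 = 1 by rewrite -Exy -expgM.
    rewrite expgMn // t2 mulg1 => /(class_mul_cubes_expg2 G4 Gx Gw x3 w3)/mulg1_eq => E.
    by rewrite -E eqxx in wxV.
  apply: (mulIg t); rewrite -expg2E t2.
  have : (x * w * t) ^+ 3 = 1 by rewrite -Exy -expgM.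
  by rewrite expgMn // (expgS t 2) t2 mulg1.
move Du: (w^-1 * x) => u.
have Gu : u \in G by rewrite -Du groupM ?groupV.
have uy : u ^ y = u^-1 by rewrite -Du conjMg conjVg wy Dw invMg invgK.
have [u4 | u6] := class_order G4 Gu.
  have u2 : u ^+ 2 != 1.
    apply: contraNneq xw; rewrite -Du => E.
    have wV3 : w^-1 ^+ 3 = 1 by rewrite expgVn w3 invg1.
    have /mulg1_eq := class_mul_cubes_expg2 G4 (groupVr Gw) Gx wV3 x3 E.
    by rewrite invgK => ->.
  have elt2 (z : gT) : z ^+ 4 = 1 -> 2.-group <[z]>.
    move/eqP; rewrite -order_dvdn => d4.
    by rewrite /pgroup -orderE; apply: pnat_dvd d4 _.
  (* As [y] inverts [u], this is a 2-group, so [u] fixes or inverts [y]. Fixing gives [u^2 = 1];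
     inverting gives [u^2 = y^2 = t], a quaternion group on which [class_no_SL23] applies with
     [x]. *)
  pose H := (<[u]> <*> <[y]>)%G.
  have nuy : <[y]> \subset 'N(<[u]>) by rewrite norms_cycle uy groupV cycle_id.
  have H2 : 2.-group H by rewrite /= norm_joinEr // pgroupM !elt2.
  have sHG : H \subset G by rewrite join_subG !cycle_subG Gu.
  have Hu : u \in H by rewrite mem_gen // inE cycle_id.
  have Hy : y \in H by rewrite mem_gen // inE cycle_id orbT.
  have [yu | yu] := class_2group_conj G4 sHG H2 Hy Hu.
    case/eqP: u2; rewrite expg2E; apply/eqP; rewrite -eq_invg_mul -uy; apply/eqP.
    by apply: commute_conj_fix; apply/commute_sym/conj_fix_commute.
  have uu : u * u = t.
    have uVy : u^-1 * y = y * u by rewrite (conjgC u^-1 y) conjVg uy invgK.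
    move: yu; rewrite conjgE -uVy mulgA -invMg => E.
    apply: invg_inj; rewrite tV -Dt -[LHS](mulgK y) E -invMg Dt tV.
    by [].
  apply: (class_no_SL23 G4 Gx Gu x3 u4 u2); first by rewrite uu.
  have -> : u * u ^ x * u ^ x^-1 = w^-1 * w^-1 * (x * x * x) * w^-1.
    by rewrite -Du !conjgE; group_nf.
  by rewrite -expg3E x3 mulg1 -expg3E expgVn w3 invg1.
move Ds: (u ^+ 3) => s.
have s2 : s ^+ 2 = 1 by rewrite -Ds -expgM.
have Gs : s \in G by rewrite -Ds groupX.
have csu : commute s u by rewrite -Ds; apply/commute_sym/commuteX.
have [xs | xs] := class_invol_normalizes G4 Gs Gx s2 x3.
  have csx : commute s x by apply/commute_sym/conj_fix_commute.
  have wVwV : w^-1 * w^-1 = w by rewrite -invMg (invg_expg3 w3) invgK.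
  have xwV3 : (x * w^-1) ^+ 3 = s.
    have -> : x * w^-1 = u ^ x^-1 by rewrite -Du conjgE; group_nf.
    by rewrite -conjXg Ds; apply/commute_conj_fix/commuteV.
  (* The conjugate elements [a b = x^-1 t] and [b a = x^-1 s] have cubes [t] and [s]. Since [t]
     commutes with [b], this gives [s = t]; so [a] and [b] commute and [t = a^3 b^3 = 1]. *)
  move Da: (x ^ w^-1) => a; move Db: (x ^ w) => b.
  have ab : a * b = x^-1 * t.
    apply: (mulgI x); rewrite mulKVg -xw3 expg3E -Da -Db !conjgE invgK !mulgA.
    by rewrite -(mulgA _ w^-1 w^-1) wVwV.
  have ba : b * a = x^-1 * s.
    apply: (mulgI x); rewrite mulKVg -xwV3 expg3E -Da -Db !conjgE invgK !mulgA.
    by rewrite -(mulgA _ w w) (invg_expg3 w3).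
  have cub z : z ^+ 2 = 1 -> commute z x -> (x^-1 * z) ^+ 3 = z.
    move=> z2 czx; rewrite expgMn; last by apply/commute_sym/commuteV.
    by rewrite expgVn x3 invg1 mul1g expgS z2 mulg1.
  have ctb : commute t b.
    by rewrite -Db conjgE; apply: commuteM; [apply: commuteV | apply: commuteM].
  have st : s = t.
    rewrite -(cub s s2 csx) -(cub t t2 ctx) -ba -ab.
    have -> : b * a = (a * b) ^ b^-1 by rewrite conjgE; group_nf.
    by rewrite -conjXg ab cub //; apply/commute_conj_fix/commuteV.
  case/eqP: t1; rewrite -(cub t t2 ctx) -ab expgMn; last by rewrite /commute ab ba st.
  by rewrite -Da -Db -!conjXg x3 !conj1g mulg1.
have Dw' : w = x * u^-1 by rewrite -Du invMg mulKVg invgK.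
have ws : w ^ s = x^-1 * u^-1.
  by rewrite Dw' conjMg xs conjVg (commute_conj_fix (commute_sym csu)).
have [E | E] := class_invol_normalizes G4 Gs Gw s2 w3.
  case/eqP: x2; rewrite expg2E -{2}[x]invgK; apply/eqP; rewrite -eq_mulgV1; apply/eqP.
  by apply: (mulIg u^-1); rewrite -ws E.
case/eqP: xw; move: E; rewrite ws -Du invMg invgK mulgA -invMg (invg_expg3 x3) invgK => E.
by apply: (mulIg w); rewrite E (invg_expg3 w3).
Qed.

End Class4.

(** * Integral Cayley graphs *)

(** Factoring [b^4 - 1] and [b^6 - 1] leaves [b^2] equal to [1], [-1], [-b - 1] or [b - 1], and
    [b + b^-1] is 2 or -2, 0, -1, 1 respectively. *)
Lemma unity_root_trace46 (b : algC) : (b ^+ 4 = 1)%R \/ (b ^+ 6 = 1)%R ->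
  (b + b^-1)%R \is a Num.int.
Proof.
have root2 : (b ^+ 2 = 1)%R -> (b + b^-1)%R \is a Num.int.
  by move/eqP; rewrite sqrf_eq1 => /orP[]/eqP->;
    rewrite ?invrN ?invr1 rpredD ?rpredN ?rpred1.
have inv c : (b * c = 1)%R -> b^-1%R = c.
  by move=> bc; apply: (mulfI (x := b)); rewrite ?bc ?divff //; apply/eqP=> b0;
    move/eqP: bc; rewrite b0 mul0r eq_sym oner_eq0.
case=> /eqP bn.
  have : ((b ^+ 2 - 1) * (b ^+ 2 + 1) == 0)%R by rewrite -subr_sqr -exprM expr1n subr_eq0.
  rewrite mulf_eq0 subr_eq0 addr_eq0 => /orP[/eqP/root2 // | /eqP b2].
  by rewrite (inv (- b)%R) ?subrr ?rpred0 // GRing.mulrN -expr2 b2 opprK.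
have : ((b ^+ 2 - 1) * (b ^+ 2 + b + 1) * (b ^+ 2 - b + 1) == 0)%R.
  by rewrite -(subr_eq0 _ 1%R) in bn; rewrite -(eqP bn); apply/eqP; ring.
rewrite !mulf_eq0 subr_eq0 => /orP[/orP[/eqP/root2 //|]|] /eqP b2.
  have Eb : (b ^+ 2 = - b - 1)%R by apply/eqP; rewrite -subr_eq0 -b2; apply/eqP; ring.
  rewrite (inv (- b - 1)%R) ?rpred1; first by rewrite addrA subrr GRing.add0r rpredN rpred1.
  by rewrite mulrBr GRing.mulrN -expr2 Eb; ring.
have Eb : (b ^+ 2 = b - 1)%R by apply/eqP; rewrite -subr_eq0 -b2; apply/eqP; ring.
rewrite (inv (1 - b)%R); first by rewrite addrC subrK rpred1.
by rewrite mulrBr -expr2 Eb; ring.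
Qed.

(** * Spectra of sums over normalized sets and cosets *)

Section Spectrum.

Variables (gT : finGroupType) (G : {group gT}).
Implicit Types (g h s t x y : gT) (A B K S : {set gT}) (N Z : {group gT}).
Notation U := (regmx G).

Lemma setmxID S K : setmx G S = (setmx G (S :&: K) + setmx G (S :\: K))%R.
Proof. exact: big_setID. Qed.

Lemma setmx_norm_comm K h : K \subset G -> h \in G -> h \in 'N(K) ->
  (setmx G K * U h = U h * setmx G K)%R.
Proof.
move=> sKG Gh nKh; rewrite /setmx mulr_suml mulr_sumr.
rewrite [RHS](reindex_inj (conjg_inj h)) /=.
apply: eq_big => [k | k Kk]; first by rewrite memJ_norm.
by have Gk := subsetP sKG k Kk; rewrite -regmxM // -regmxM // conjgC.
Qed.

Lemma setmx_comm_set K S : K \subset G -> S \subset G -> S \subset 'N(K) ->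
  (setmx G K * setmx G S = setmx G S * setmx G K)%R.
Proof.
move=> sKG sSG nKS.
have : {in S, forall s, setmx G K * U s = U s * setmx G K}%R.
  by move=> s Ss; apply: setmx_norm_comm; rewrite ?(subsetP sSG) ?(subsetP nKS).
move: (setmx G K) => T cT; rewrite /setmx mulr_suml mulr_sumr.
exact: eq_bigr.
Qed.

(** The sum commutes with [s], so an eigenvector for [a] can be chosen with an eigenvalue [b] of
    [s], where [b^4 = 1] or [b^6 = 1]. Then [a = b + b^-1], except that [a = b] with [b^2 = 1] when
    the set collapses to one element. *)
Lemma int_spectrum_regmx s : s \in G -> s ^+ 4 = 1 \/ s ^+ 6 = 1 ->
  int_spectrum (setmx G [set s; s^-1]).
Proof.
move=> Gs sn a eTa; set T := setmx G _ in eTa.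
have sSG : [set s; s^-1] \subset G by rewrite subUset !sub1set groupV Gs.
have cTs : (T * U s = U s * T)%R.
  apply: setmx_norm_comm => //; rewrite inE conjUg !conjg_set1 conjVg.
  by rewrite (conjgE s s) mulKg.
have [v v0 [vT [b vs]]] := comm_eigenvector cTs eTa.
have vsn n : (v *m U (s ^+ n)%g = (b ^+ n) *: v)%R.
  elim: n => [|n IHn]; first by rewrite expg0 regmx1 mulmx1 expr0 scale1r.
  by rewrite expgSr regmxM ?groupX // [(_ * _)%R]/(_ *m _)%R mulmxA IHn -scalemxAl vs
    scalerA exprSr.
have bn n : s ^+ n = 1 -> (b ^+ n = 1)%R.
  move=> sn1; apply/eqP; rewrite -subr_eq0; have := vsn n.
  rewrite sn1 regmx1 mulmx1 => /eqP; rewrite -{1}[v]scale1r -subr_eq0 -scalerBl.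
  by rewrite scaler_eq0 (negPf v0) orbF -oppr_eq0 opprB.
have b46 : (b ^+ 4 = 1)%R \/ (b ^+ 6 = 1)%R by case: sn => /bn; [left | right].
have b0 : b != 0%R.
  by apply/eqP=> b0; case: b46 => /eqP; rewrite b0 expr0n eq_sym oner_eq0.
have [sV | sV] := eqVneq s s^-1.
  have Da : a = b.
    apply/eqP; rewrite -subr_eq0; have /eqP := vT.
    rewrite /T /setmx -sV setUid big_set1 vs -subr_eq0 -scalerBl scaler_eq0 (negPf v0) orbF.
    by rewrite -oppr_eq0 opprB.
  have /bn/eqP : s ^+ 2 = 1 by rewrite expg2E {2}sV mulgV.
  by rewrite Da sqrf_eq1 => /orP[]/eqP->; rewrite ?rpredN rpred1.
have vV : (v *m U s^-1%g = b^-1 *: v)%R.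
  apply: (scalerI b0); rewrite scalerA divff // scale1r scalemxAl -vs -mulmxA.
  have -> : (U s *m U s^-1%g = 1%:M)%R.
    by rewrite -[LHS]/(U s * U s^-1%g)%R -regmxM // mulgV regmx1.
  by rewrite mulmx1.
suff -> : a = (b + b^-1)%R by apply: unity_root_trace46.
apply/eqP; rewrite -subr_eq0; have /eqP := vT.
rewrite /T /setmx big_setU1 ?inE //= big_set1 mulmxDr vs vV -scalerDl -subr_eq0 -scalerBl.
by rewrite scaler_eq0 (negPf v0) orbF -oppr_eq0 opprB.
Qed.

(** Induction on the size of [S], removing a pair [{s, s^-1}]: conjugation by elements of [S]
    preserves the pair, so its sum commutes with the sum over the rest. *)
Lemma int_spectrum_setmx_conj S : S \subset G -> S^-1 = S ->
    {in S, forall s, s ^+ 4 = 1 \/ s ^+ 6 = 1} ->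
    {in S &, forall s g, s ^ g = s \/ s ^ g = s^-1} ->
  int_spectrum (setmx G S).
Proof.
have [n] := ubnP #|S|; elim: n S => // n IHn S ltSn sSG SV Sn Sc.
have [-> | [s Ss]] := set_0Vmem S.
  by rewrite /setmx big_set0; apply: int_spectrum0.
pose K := [set s; s^-1].
have sKS : K \subset S by rewrite subUset !sub1set Ss -SV inE invgK Ss.
have sS'S : S :\: K \subset S by apply: subsetDl.
rewrite (setmxID S K) (setIidPr sKS); apply: int_spectrumD.
- apply: setmx_comm_set; rewrite ?(subset_trans _ sSG) //.
  apply/subsetP=> g /(subsetP sS'S) Sg; rewrite inE conjUg !conjg_set1 conjVg subUset
    !sub1set.
  by case: (Sc s g Ss Sg) => ->; rewrite !inE ?invgK !eqxx ?orbT.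
- by apply: int_spectrum_regmx; [apply: (subsetP sSG) | apply: Sn].
apply: IHn.
- rewrite -ltnS; apply: leq_trans ltSn; rewrite ltnS; apply: proper_card;
  rewrite properEneq sS'S andbT.
  by apply: contraTneq Ss => <-; rewrite !inE eqxx.
- exact: subset_trans sSG.
- by apply/setP=> g; rewrite !inE (inj_eq invg_inj) eqg_invLR orbC -[in RHS]SV inE.
- by move=> g /(subsetP sS'S); apply: Sn.
by move=> g h /(subsetP sS'S) Sg /(subsetP sS'S); apply: Sc.
Qed.

Lemma setmx_rcoset A g : A \subset G -> setmx G (A :* g) = (setmx G A * U g)%R.
Proof.
move=> sAG; rewrite /setmx -rcosetE big_imset /=; last by move=> a b _ _; apply: mulIg.
by rewrite mulr_suml; apply: eq_bigr => a Aa; rewrite regmxM ?(subsetP sAG).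
Qed.

Lemma setmx_group_mull N n : N \subset G -> n \in N -> (setmx G N * U n = setmx G N)%R.
Proof. by move=> sNG Nn; rewrite -setmx_rcoset // rcoset_id. Qed.

Lemma setmx_group_sqr N : N \subset G -> (setmx G N * setmx G N = #|N|%:R *: setmx G N)%R.
Proof.
move=> sNG; rewrite {2}/setmx mulr_sumr (eq_bigr (fun=> setmx G N)).
  by rewrite GRing.sumr_const scaler_nat.
by move=> n Nn; rewrite setmx_group_mull.
Qed.

Lemma int_spectrum_cubic n (T : 'M[algC]_n) (m : nat) :
  (T * T * T = (m%:R ^+ 2) *: T)%R -> int_spectrum T.
Proof.
move=> T3 a /eigenvalueP[v vT v0].
have : (a * ((a - m%:R) * (a + m%:R)) == 0)%R.
  suff : ((a * ((a - m%:R) * (a + m%:R))) *: v == 0)%R by rewrite scaler_eq0 (negPf v0)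
    orbF.
  have := congr1 (mulmx v) T3.
  rewrite -[(T * T * T)%R]/(T *m T *m T)%R !mulmxA vT -!scalemxAl vT -scalemxAl vT
    -scalemxAr vT => E.
  have -> : (a * ((a - m%:R) * (a + m%:R)) = a * a * a - m%:R ^+ 2 * a)%R by ring.
  by rewrite scalerBl -(scalerA (a * a)) -(scalerA a a) E -(scalerA (_ ^+ 2)) subrr.
rewrite !mulf_eq0 subr_eq0 addr_eq0 => /or3P[]/eqP->; rewrite ?rpred0 ?rpredN //;
  exact: rpred_nat.
Qed.

(** Since [g] normalizes [N] and [g^2] lies in [N], the coset sum [T] has [T^2] equal to [|N|] times
    the sum over [N], and [T^3 = |N|^2 T]. *)
Lemma int_spectrum_rcoset N g : N \subset G -> g \in G -> g \in 'N(N) -> g ^+ 2 \in N ->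
  int_spectrum (setmx G (N :* g)).
Proof.
move=> sNG Gg nNg g2; apply: (@int_spectrum_cubic _ _ #|N|).
have cg := setmx_norm_comm sNG Gg nNg.
have TT : (setmx G (N :* g) * setmx G (N :* g) = #|N|%:R *: setmx G N)%R.
  rewrite setmx_rcoset // {2}cg -!GRing.mulrA (GRing.mulrA (U g)) -regmxM // -expg2E.
  have cg2 := setmx_norm_comm sNG (subsetP sNG _ g2) (subsetP (normG N) _ g2).
  by rewrite -cg2 setmx_group_mull // setmx_group_sqr.
rewrite TT scaler_mulmx setmx_rcoset // GRing.mulrA setmx_group_sqr // scaler_mulmx scalerA.
by rewrite expr2.
Qed.

(** The sum is the difference of the sums over [N h] and [Z h]; these commute because [h] normalizes
    both groups. *)
Lemma int_spectrum_rcosetD N Z h : Z \subset N -> N \subset G -> h \in G ->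
    h \in 'N(N) -> h \in 'N(Z) -> h ^+ 2 \in Z ->
  int_spectrum (setmx G (N :* h :\: Z :* h)).
Proof.
move=> sZN sNG Gh nNh nZh h2; have sZG := subset_trans sZN sNG.
have sZhNh : Z :* h \subset N :* h by rewrite mulSg.
have -> : setmx G (N :* h :\: Z :* h) = (setmx G (N :* h) - setmx G (Z :* h))%R.
  by rewrite (setmxID (N :* h) (Z :* h)) (setIidPr sZhNh) [RHS]addrAC subrr GRing.add0r.
apply: int_spectrumB; first last.
- exact: int_spectrum_rcoset.
- by apply: int_spectrum_rcoset => //; apply: (subsetP sZN).
rewrite !setmx_rcoset // -!GRing.mulrA (GRing.mulrA (U h)) -(setmx_norm_comm sZG Gh nZh).
rewrite (GRing.mulrA (U h)) -(setmx_norm_comm sNG Gh nNh) !GRing.mulrA.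
by rewrite (setmx_comm_set sNG sZG) // (subset_trans sZN) ?normG.
Qed.

End Spectrum.

(** * Spectra in an extension of an abelian group of exponent 3 by an inverting element *)

Section GeneralizedDicyclic.

Variables (gT : finGroupType) (G P : {group gT}) (x : gT).
Implicit Types (g h s : gT) (S B : {set gT}).

(** The case [x^2 = 1] is included, so that generalized dihedral groups such as the symmetric group
    of degree 3 are treated along with the dicyclic ones. *)
Definition dicyclic_over :=
  [/\ P \subset G, abelian P /\ {in P, forall p, p ^+ 3 = 1}, x \in G /\ x ^+ 4 = 1,
      {in P, forall p, p ^ x = p^-1} & P <*> <[x]> = G].

Hypothesis dG : dicyclic_over.

Let t := x ^+ 2.
Let Z := <[t]>%G.
Let E := (P <*> Z)%G.

Lemma dic_t2 : t ^+ 2 = 1.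
Proof. by have [_ _ [_ x4] _ _] := dG; rewrite -expgM. Qed.

Lemma dic_Z z : z \in Z -> z = 1 \/ z = t.
Proof.
case/cycleP=> i ->; rewrite -(expg_mod i dic_t2) modn2.
by case: (odd i); [right; rewrite expg1 | left; rewrite expg0].
Qed.

Lemma dic_commPt p : p \in P -> commute p t.
Proof.
have [_ _ _ px _] := dG => Pp; apply: conj_fix_commute.
by rewrite /t expg2E conjgM !px ?invgK // groupV.
Qed.

Lemma dic_centPZ : Z \subset 'C(P).
Proof. by rewrite cycle_subG; apply/centP=> p Pp; apply/commute_sym/dic_commPt. Qed.

Lemma dic_memE g : g \in E -> exists2 p, p \in P & exists2 z, z \in Z & g = p * z.
Proof.
rewrite /= cent_joinEr ?dic_centPZ // => /mulsgP[p z Pp Zz ->].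
by exists p => //; exists z.
Qed.

Lemma dic_abelE : abelian E.
Proof.
have [_ [cPP _] _ _ _] := dG.
by rewrite /= cent_joinEr ?dic_centPZ // abelianM cPP cycle_abelian dic_centPZ.
Qed.

Lemma dic_conjE e : e \in E -> e ^ x = e^-1.
Proof.
have [_ _ _ px _] := dG; case/dic_memE=> p Pp [z Zz ->].
have zx : z ^ x = z^-1.
  case: (dic_Z Zz) => ->; first by rewrite conj1g invg1.
  by rewrite (invg_expg2 dic_t2); apply/commute_conj_fix/commute_sym/commuteX.
have cpz : commute p z by case: (dic_Z Zz) => ->; [apply: commute1 | apply: dic_commPt].
by rewrite conjMg px // zx -invMg cpz.
Qed.

Lemma dic_mem g : g \in G -> g \in E \/ exists2 e, e \in E & g = e * x.
Proof.
have [_ _ _ px <-] := dG.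
have nxP : <[x]> \subset 'N(P).
  by rewrite cycle_subG inE; apply/subsetP=> _ /imsetP[p Pp ->]; rewrite px ?groupV.
rewrite /= norm_joinEr // => /mulsgP[p _ Pp /cycleP[i ->] ->].
have Ep : p * t ^+ i./2 \in E.
  apply: groupM; first by rewrite mem_gen // inE Pp.
  by apply: groupX; rewrite mem_gen // inE cycle_id orbT.
rewrite -(odd_double_half i) expgD -muln2 mulnC expgM -/t.
case: (odd i); last by left; rewrite mul1g.
right; exists (p * t ^+ i./2) => //; rewrite expg1 -mulgA; congr (_ * _).
exact/commuteX/commuteX.
Qed.

Lemma dic_sub : [/\ Z \subset G, E \subset G & P \subset E].
Proof.
have [sPG _ [Gx _] _ _] := dG.
have sZG : Z \subset G by rewrite cycle_subG groupX.
by split=> //; [rewrite join_subG sPG | apply: joing_subl].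
Qed.

(** Such a [g] is [e x] with [e] in the abelian group [E], which [x] inverts; so [g] inverts [E]
    too, and [g^2 = e e^-1 x^2]. *)
Lemma dic_out g : g \in G -> g \notin E ->
  g ^+ 2 = t /\ {in E, forall e, e ^ g = e^-1}.
Proof.
move=> Gg; case: (dic_mem Gg) => [-> // | [e0 Ee0 ->] _].
have xe : x * e0 = e0^-1 * x by have := conjgC e0^-1 x; rewrite conjVg dic_conjE // invgK.
split=> [|e Ee]; first by rewrite expg2E -mulgA (mulgA x) xe -mulgA mulKVg.
rewrite conjgM (commute_conj_fix (_ : commute e e0)) ?dic_conjE //.
exact: (centsP dic_abelE).
Qed.

Lemma dic_div g h : g \in G -> h \in G -> g \notin E -> h \notin E -> h * g^-1 \in E.
Proof.
move=> Gg Gh; case: (dic_mem Gg) => [-> // | [e Ee ->] _].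
case: (dic_mem Gh) => [-> // | [e' Ee' ->] _].
by rewrite invMg mulgA mulgK groupM ?groupV.
Qed.

Lemma dic_norm g p : g \in G -> g \notin E -> p \in P ->
  [/\ g \in 'N(Z), g \in 'N(<[p]> <*> Z), g ^+ 2 \in Z & t ^ g = t].
Proof.
move=> Gg nEg Pp; have [g2 cE] := dic_out Gg nEg; have [sZG sEG sPE] := dic_sub.
have Et : t \in E by rewrite mem_gen // inE cycle_id orbT.
have tg : t ^ g = t by rewrite cE // (invg_expg2 dic_t2).
have pg : p ^ g = p^-1 by rewrite cE // (subsetP sPE).
have nZ : <[g]> \subset 'N(Z) by rewrite norms_cycle tg cycle_id.
split=> //; last by rewrite g2 cycle_id.
  by rewrite -cycle_subG.
by rewrite -cycle_subG /= normsY // norms_cycle pg groupV cycle_id.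
Qed.

(* [B] is a union of right cosets of <x^2>: one coset, two cosets, i.e. a coset of
   <p, x^2> minus a third one, or a full coset of <p, x^2>. *)
Lemma int_spectrum_dicyclic_out B : B \subset G :\: E -> B^-1 = B ->
  #|B| < 3 * #[t] \/ #|P| = 3 -> int_spectrum (setmx G B).
Proof.
move=> /subsetP sB BV cardB; have [sPG [cPP P3] [Gx x4] px defG] := dG.
have [sZG sEG sPE] := dic_sub.
have BG h : h \in B -> h \in G by move/sB/setDP=> [].
have BE h : h \in B -> h \notin E by move/sB/setDP=> [].
(* As [h^2 = t] and [t^2 = 1], the coset [Z h] is [{h, h^-1}], and [B] is closed under inverses. *)
have sZB h : h \in B -> Z :* h \subset B.
  move=> Bh; have [h2 cE] := dic_out (BG h Bh) (BE h Bh).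
  apply/subsetP=> _ /rcosetP[z Zz ->]; case: (dic_Z Zz) => ->; first by rewrite mul1g.
  have -> : t * h = h^-1; last by rewrite -BV inE invgK.
  by rewrite -h2 expg2E (@invg_expg4 _ h) // (expgM h 2 2) h2 dic_t2.
have [-> | [g Bg]] := set_0Vmem B.
  by rewrite /setmx big_set0; apply: int_spectrum0.
have [nZg _ g2 _] := dic_norm (BG g Bg) (BE g Bg) (group1 P).
have [sBZg | /subsetPn[h0 Bh0 nZh0]] := boolP (B \subset Z :* g).
  have -> : B = Z :* g by apply/eqP; rewrite eqEsubset sBZg sZB.
  by apply: int_spectrum_rcoset => //; apply: BG.
have [p Pp [z Zz Dh0]] := dic_memE (dic_div (BG g Bg) (BG h0 Bh0) (BE g Bg) (BE h0 Bh0)).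
have cpz : commute p z by case: (dic_Z Zz) => ->; [apply: commute1 | apply: dic_commPt].
have {}Dh0 : h0 = z * (p * g) by rewrite mulgA -cpz -Dh0 mulgKV.
pose h := p * g; have Bh : h \in B.
  apply: (subsetP (sZB h0 Bh0)); apply/rcosetP; exists z^-1; first by rewrite groupV.
  by rewrite Dh0 mulKg.
have nZp : p \notin Z by apply: contra nZh0 => Zp;
  rewrite Dh0 mulgA mem_rcoset mulgK groupM.
(* [N g] is the union of the cosets of [Z] through [g], [p g] and [p^-1 g]. When [B] consists of the
   first two, [r] represents the missing one. *)
pose N := (<[p]> <*> Z)%G; pose r := p^-1 * g.
have Np : p \in N by rewrite mem_gen // inE cycle_id.
have sZN : Z \subset N by apply: joing_subr.
have sNE : N \subset E by rewrite join_subG cycle_subG (subsetP sPE) ?joing_subr.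
have sNG : N \subset G := subset_trans sNE sEG.
have Gr : r \in G by apply: groupM; [rewrite groupV (subsetP sPG) | apply: BG].
have EpV : p^-1 \in E by rewrite groupV (subsetP sPE).
have nEr : r \notin E by rewrite /r (groupMl _ EpV) BE.
have [nZr nNr r2 _] := dic_norm Gr nEr Pp.
have [_ nNg _ _] := dic_norm (BG g Bg) (BE g Bg) Pp.
have p1 : p != 1 by apply: contraNneq nZp => ->; apply: group1.
have cardN : #|N| <= 3 * #|Z|.
  have p3 : #[p] <= 3 by apply: dvdn_leq; rewrite // order_dvdn P3.
  have cpZ : Z \subset 'C(<[p]>) by rewrite (subset_trans dic_centPZ) // centS //
    cycle_subG.
  rewrite /= cent_joinEr //; apply: leq_trans (leq_mul p3 (leqnn _)).
  by rewrite orderE mul_cardG leq_pmulr ?cardG_gt0.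
have nZgh : h \notin Z :* g by rewrite mem_rcoset mulgK.
have disj a b : b \notin Z :* a -> [disjoint Z :* a & Z :* b].
  move=> nab; rewrite -setI_eq0; apply: contraNT nab => /set0Pn[y /setIP[/rcoset_eqP Ea
    /rcoset_eqP Eb]].
  by rewrite -Ea Eb rcoset_refl.
have cardB2 : #|Z :* g :|: Z :* h| = (2 * #|Z|)%N.
  by rewrite cardsU disjoint_setI0 ?disj // cards0 subn0 !card_rcoset addnn mul2n.
have [sB2 | /subsetPn[k Bk]] := boolP (B \subset Z :* g :|: Z :* h).
  suff -> : B = N :* r :\: Z :* r.
    by apply: int_spectrum_rcosetD.
  apply/eqP; rewrite eqEcard; apply/andP; split.
    have nZpV : p^-1 \notin Z by rewrite groupV.
    have rV : r^-1 = g^-1 * p by rewrite invMg invgK.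
    have hV : h^-1 = g^-1 * p^-1 by rewrite invMg.
    apply/subsetP=> b /(subsetP sB2); rewrite inE [b \in _ :\: _]inE !mem_rcoset rV hV
      !mulgA.
    case/orP=> Zb; first by rewrite (groupMl _ Zb) nZp groupM // (subsetP sZN).
    have -> : b * g^-1 * p = b * g^-1 * p^-1 * p^-1.
      by rewrite -!mulgA -invMg (invg_expg3 (P3 p Pp)) invgK.
    by rewrite (groupMl _ Zb) nZpV groupM ?groupV // (subsetP sZN).
  have sZrNr : Z :* r \subset N :* r by rewrite mulSg.
  rewrite cardsD (setIidPr sZrNr) !card_rcoset leq_subLR.
  apply: leq_trans cardN _; rewrite (_ : 3 * _ = #|Z| + 2 * #|Z|)%N // leq_add2l -cardB2.
  by rewrite subset_leq_card // subUset !sZB.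
rewrite inE negb_or => /andP[nZgk nZhk].
have cardB3 : 3 * #|Z| <= #|B|.
  have sB3 : (Z :* g :|: Z :* h) :|: Z :* k \subset B by rewrite !subUset !sZB.
  apply: leq_trans (subset_leq_card sB3).
  rewrite cardsU setIUl !disjoint_setI0 ?disj // setU0 cards0 subn0 cardB2 card_rcoset.
  by rewrite -mulSnr.
(* Three cosets contradict the bound on [B]. So [|P| = 3], hence [P = <p>] and [N = E], and [B] is
   the full coset [N g]. *)
case: cardB => [|cardP]; first by rewrite orderE ltnNge cardB3.
have defP : <[p]> = P.
  by apply/eqP; rewrite eqEcard cycle_subG Pp cardP -orderE (nt_prime_order _ (P3 p Pp)).
have -> : B = N :* g.
  apply/eqP; rewrite eqEcard card_rcoset (leq_trans cardN cardB3) andbT.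
  apply/subsetP=> b Bb; rewrite mem_rcoset /= defP.
  by apply: dic_div; rewrite ?BG ?BE.
by apply: int_spectrum_rcoset => //; [apply: BG | apply: (subsetP sZN)].
Qed.

(** Elements outside [E] invert [E], hence normalize [S :&: E], so the sums over the two parts of
    [S] commute. The part inside lies in an abelian group whose elements have sixth power 1. *)
Lemma int_spectrum_dicyclic S : S \subset G -> S^-1 = S ->
  #|S| < 3 * #[t] \/ #|P| = 3 -> int_spectrum (setmx G S).
Proof.
move=> sSG SV cardS; have [sZG sEG sPE] := dic_sub; have [_ [_ P3] _ _ _] := dG.
have sS1 : S :&: E \subset S := subsetIl S E.
have sS2 : S :\: E \subset S := subsetDl S E.
rewrite (setmxID G S E); apply: int_spectrumD.
- apply: setmx_comm_set; rewrite ?(subset_trans _ sSG) //.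
  apply/subsetP=> g /setDP[Sg nEg]; rewrite inE;
    apply/subsetP=> _ /imsetP[s /setIP[Ss Es] ->].
  by rewrite (dic_out (subsetP sSG g Sg) nEg).2 // !inE groupV Es -SV inE invgK Ss.
- apply: int_spectrum_setmx_conj; first exact: subset_trans sSG.
  + by apply/setP=> g; rewrite !inE groupV -{2}SV inE.
  + move=> s /setIP[_ /dic_memE[p Pp [z Zz ->]]]; right.
    have cpz : commute p z by case: (dic_Z Zz) => ->; [apply: commute1 | apply: dic_commPt].
    rewrite expgMn // (expgM p 3 2) P3 // expg1n mul1g (expgM z 2 3).
    by case: (dic_Z Zz) => ->; rewrite ?dic_t2 !expg1n.
  by move=> s g /setIP[_ Es] /setIP[_ Eg]; left; apply/commute_conj_fix/(centsP dic_abelE).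
apply: int_spectrum_dicyclic_out; first by rewrite setSD.
  by apply/setP=> g; rewrite !inE groupV -{2}SV inE.
by case: cardS => [lt | ->]; [left | right];
  rewrite // (leq_ltn_trans (subset_leq_card sS2)).
Qed.

End GeneralizedDicyclic.

(** * The structure of groups in class 4 *)

Section Class4.

Variables (gT : finGroupType) (G : {group gT}).
Hypothesis G4 : in_class 4 G.

Lemma class_3elt x : x \in G -> 3.-elt x -> x ^+ 3 = 1.
Proof.
move=> Gx x3; case: (class_order G4 Gx) => [x4 | x6].
  have x2 : x ^+ 2 = 1 by apply: (@p_elt_expg_prime _ 3 2); rewrite ?p_eltX // -expgM.
  by rewrite (@p_elt_expg_prime _ 3 2 x) ?expg1n.
by apply: (@p_elt_expg_prime _ 3 2); rewrite ?p_eltX // -expgM.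
Qed.

Lemma class_2elt_normalizes q x : q \in G -> 2.-elt q -> x \in G -> x ^+ 3 = 1 ->
  x ^ q = x \/ x ^ q = x^-1.
Proof.
move=> Gq q2 Gx x3; have q4 := class_2elt G4 Gq q2.
have [q2_1 | nq2] := eqVneq (q ^+ 2) 1; first exact: (class_invol_normalizes G4).
by right; apply: (class_order4_inverts G4).
Qed.

Lemma class_pi p : prime p -> p %| #|G| -> p \in [:: 2; 3].
Proof.
move=> pr_p /Cauchy[]// x Gx ox; rewrite !inE.
case: (class_order G4 Gx) => /eqP; rewrite -order_dvdn ox.
  by rewrite -[4]/(2 * 2)%N Euclid_dvdM // !dvdn_prime2 // orbb => ->.
by rewrite -[6]/(2 * 3)%N Euclid_dvdM // !dvdn_prime2.
Qed.

Lemma class_Sylow_mul (P Q : {group gT}) : 3.-Sylow(G) P -> 2.-Sylow(G) Q -> P * Q = G.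
Proof.
move=> sylP sylQ; apply/eqP; rewrite eqEcard mul_subG ?(pHall_sub sylP) ?(pHall_sub sylQ)
  //=.
rewrite coprime_cardMg; last first.
  exact: (pnat_coprime (pHall_pgroup sylP) (pi_pnat (pHall_pgroup sylQ) _)).
rewrite (card_Hall sylP) (card_Hall sylQ) -[X in X <= _](partnC 3 (cardG_gt0 G)).
rewrite leq_mul // (eq_in_partn (pi2 := 2)) // => p;
  rewrite mem_primes => /and3P[pr_p _ pG].
by have := class_pi pr_p pG; rewrite !inE => /orP[]/eqP->.
Qed.

(** If [q] inverts [x0 <> 1] and fixes [y], it sends [x0 y] to [x0^-1 y]. This is not [x0 y], and it
    equals [(x0 y)^-1] only if [y = y^-1]. *)
Lemma inversion_uniform (P : {group gT}) q : abelian P -> {in P, forall x, x ^+ 3 = 1} ->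
    {in P, forall x, x ^ q = x \/ x ^ q = x^-1} ->
  {in P, forall x, x ^ q = x} \/ {in P, forall x, x ^ q = x^-1}.
Proof.
move=> cPP P3 Pq; have [/forall_inP E | ] := boolP [forall x in P, x ^ q == x].
  by left=> x /E/eqP.
rewrite negb_forall_in => /exists_inP[x0 Px0 nx0]; right=> y Py.
have x0q : x0 ^ q = x0^-1 by case: (Pq x0 Px0) => // E; rewrite E eqxx in nx0.
case: (Pq y Py) => // yq; rewrite yq.
case: (Pq (x0 * y) (groupM Px0 Py)); rewrite conjMg x0q yq.
  move/mulIg=> E; case/eqP: nx0.
  by rewrite (fixed_inverted3 (t := q) (P3 x0 Px0) _ x0q) ?conj1g // x0q.
by rewrite invMg -(centsP cPP _ (groupVr Px0) _ (groupVr Py)) => /mulgI.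
Qed.

(** Here [G = P Q] for Sylow subgroups [P] and [Q], and each element of [Q] centralizes or inverts
    [P]. If some element inverts without centralizing, take for [x] an involution of [Q] inverting
    [P] if there is one, and any inverting element otherwise. Centralizing elements of [Q] turn out
    to lie in [<x>]; as a product of two inverting elements centralizes, [Q = <x>]. *)
Theorem class4_structure :
  {in G &, forall s g, s ^ g = s \/ s ^ g = s^-1} \/
  exists (P : {group gT}) (x : gT),
    [/\ dicyclic_over G P x, P :!=: 1 & x ^+ 2 = 1 -> #|P| = 3].
Proof.
have [P sylP] := Sylow_exists 3 G; have [Q sylQ] := Sylow_exists 2 G.
have [sPG sQG] := (pHall_sub sylP, pHall_sub sylQ).
have [pP pQ] := (pHall_pgroup sylP, pHall_pgroup sylQ).
have defG := class_Sylow_mul sylP sylQ.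
have P3 : {in P, forall x, x ^+ 3 = 1}.
  by move=> x Px; apply: class_3elt; [apply: (subsetP sPG) | apply: mem_p_elt pP Px].
have cPP : abelian P.
  apply/centsP=> x Px y Py.
  by apply: (class_cubes_commute G4); rewrite ?P3 ?groupM ?groupV ?(subsetP sPG).
have PQ q : q \in Q -> {in P, forall x, x ^ q = x \/ x ^ q = x^-1}.
  move=> Qq x Px; apply: class_2elt_normalizes; last exact: P3.
  - exact: (subsetP sQG).
  - exact: mem_p_elt pQ Qq.
  exact: (subsetP sPG).
have sgn q (Qq : q \in Q) := inversion_uniform cPP P3 (PQ q Qq).
have nPQ : Q \subset 'N(P).
  apply/subsetP=> q Qq; rewrite inE; apply/subsetP=> _ /imsetP[x Px ->].
  by case: (PQ q Qq x Px) => ->; rewrite ?groupV.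
have join_gen y : y \in Q -> Q \subset <[y]> -> P <*> <[y]> = G.
  move=> Qy sQy; have -> : <[y]>%g = Q by apply/eqP; rewrite eqEsubset sQy cycle_subG Qy.
  by rewrite norm_joinEr.
have fix2 q x0 : q \in Q -> x0 \in P -> x0 != 1 -> x0 ^ q = x0 -> q ^+ 2 = 1.
  move=> Qq Px0 x01 fq; apply/eqP; apply: contraNT x01 => q2; apply/eqP.
  apply: (fixed_inverted3 (P3 x0 Px0) fq).
  have Gq := subsetP sQG q Qq; have q4 := class_2elt G4 Gq (mem_p_elt pQ Qq).
  exact: (class_order4_inverts G4 Gq (subsetP sPG x0 Px0) q4 q2 (P3 x0 Px0)).
have [cQP | ] := boolP (Q \subset 'C(P)).
  (* For [P = 1] the group is a 2-group. Otherwise elements of order 4 would invert [P], so [Q] has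
     exponent at most 2 and [G] is abelian. *)
  left; have [P1 | ntP] := eqVneq P 1%G.
    have defQ : Q :=: G by rewrite -defG P1 mul1g.
    move=> s g; rewrite -defQ => Qs Qg; exact: (class_2group_conj G4 sQG pQ).
  have [x0 Px0 x01] := trivgPn _ ntP.
  have Q2 q : q \in Q -> q ^+ 2 = 1.
    move=> Qq; apply: (fix2 q x0) => //; apply: commute_conj_fix.
    by apply/commute_sym; apply: (centsP cQP).
  have cQQ : abelian Q.
    by apply/centsP=> a Qa b Qb; apply: (class_2group_involutions G4 sQG pQ); rewrite ?Q2.
  have cGG : abelian G by rewrite -defG abelianM cPP cQQ cQP.
  by move=> s g Gs Gg; left; apply/commute_conj_fix/(centsP cGG).
case/subsetPn=> g Qg ncg; right; exists P.
have {}sgn q : q \in Q -> q \in 'C(P) \/ {in P, forall x, x ^ q = x^-1}.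
  move=> Qq; case: (sgn q Qq) => E; [left | by right].
  by apply/centP=> x Px; apply/commute_sym/conj_fix_commute/E.
have gP : {in P, forall x, x ^ g = x^-1} by case: (sgn g Qg) => // cg; rewrite cg in ncg.
have ntP : P :!=: 1 by apply: contraNneq ncg => ->; rewrite cent1T inE.
have [x0 Px0 x01] := trivgPn _ ntP.
have [Gx0 x03] := (subsetP sPG _ Px0, P3 _ Px0).
have cfix c x : c \in 'C(P) -> x \in P -> x ^ c = x.
  by move=> cc Px; apply/commute_conj_fix/commute_sym/(centP cc).
have inv_mul a b : {in P, forall x, x ^ a = x^-1} -> {in P, forall x, x ^ b = x^-1} ->
    a * b \in 'C(P).
  move=> aP bP; apply/centP=> x Px; apply/commute_sym/conj_fix_commute.
  by rewrite conjgM aP // bP ?groupV // invgK.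
have [/exists_inP[s Qs /andP[/eqP s2 /forall_inP sP]] | noinv] :=
    boolP [exists s in Q, (s ^+ 2 == 1) && [forall x in P, x ^ s == x^-1]].
  have {}sP : {in P, forall x, x ^ s = x^-1} by move=> x /sP/eqP.
  have Gs := subsetP sQG _ Qs.
  have defP : <[x0]> = P.
    apply/eqP; rewrite eqEsubset cycle_subG Px0; apply: contraT => /subsetPn[w Pw nw].
    exfalso; apply: (class_no_E9_inverted G4 Gs Gx0 (subsetP sPG _ Pw) s2); rewrite ?sP //.
    split; rewrite ?P3 //; first exact: (centsP cPP).
      by apply: contraNneq nw => ->; apply: group1.
    split=> //; apply: contraNneq nw => E; first by rewrite -E cycle_id.
    by rewrite -[w]invgK -E groupV cycle_id.
  have cardP : #|P| = 3.
    by rewrite -defP -orderE; apply: nt_prime_order.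
  (* For [c <> 1], the involutions [s] and [x0 s c] would have the product [x0^-1 c] of order 6. *)
  have trivC c : c \in Q -> c \in 'C(P) -> c = 1.
    move=> Qc cc; have c2 : c ^+ 2 = 1 by apply: (fix2 c x0) => //; apply: cfix.
    have csc : commute s c by apply: (class_2group_involutions G4 sQG pQ).
    have sc2 : (s * c) ^+ 2 = 1 by rewrite expgMn // s2 c2 mulg1.
    have scP : x0 ^ (s * c) = x0^-1 by rewrite conjgM sP // cfix ?groupV.
    have Gsc : s * c \in G by rewrite groupM ?(subsetP sQG).
    have := class_mul_involution G4 Gs (groupM Gx0 Gsc) s2 (invol_mul_inverted sc2 scP).
    have -> : s * (x0 * (s * c)) = x0^-1 * c.
      by rewrite mulgA (mulg_invol_conj x0 s2) sP // -mulgA (mulgA s) -expg2E s2 mul1g.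
    have cx0c : commute x0^-1 c by apply/commute_sym/(centP cc); rewrite groupV.
    rewrite !expgMn // c2 mulg1 expgVn (expg2E x0) (invg_expg3 x03) invgK expgVn x03 invg1
      mul1g.
    case=> [E | ]; first by rewrite E eqxx in x01.
    by rewrite expgS c2 mulg1.
  exists s; split=> //; split=> //; first by split=> //; rewrite (expgM s 2 2) s2 expg1n.
  apply: join_gen => //; apply/subsetP=> r Qr.
  case: (sgn r Qr) => [cr | rP]; first by rewrite (trivC r) ?group1.
  have /mulg1_eq <- : s * r = 1 by apply: trivC; [apply: groupM | apply: inv_mul].
  by rewrite groupV cycle_id.
have g2 : g ^+ 2 != 1.
  apply: contra noinv => g2; apply/exists_inP; exists g => //; rewrite g2 /=.
  by apply/forall_inP=> x Px; rewrite gP.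
have Gg := subsetP sQG _ Qg.
have g4 : g ^+ 4 = 1 by apply: (class_2elt G4) => //; apply: mem_p_elt pQ Qg.
(* Fixing [x0] forces [c^2 = 1]; an involution other than [g^2] is excluded by
   [class_no_Dic12xZ2]. *)
have centC c : c \in Q -> c \in 'C(P) -> c \in <[g]>.
  move=> Qc cc; have c2 : c ^+ 2 = 1 by apply: (fix2 c x0) => //; apply: cfix.
  have [-> | c1] := eqVneq c 1; first exact: group1.
  have [-> | cg2] := eqVneq c (g ^+ 2); first exact: mem_cycle.
  exfalso; apply: (class_no_Dic12xZ2 G4 Gx0 Gg (subsetP sQG _ Qc) x03 x01 g4 g2 _ c2 _ _
    c1 cg2).
  - exact: gP.
  - exact: (centP cc).
  by apply/commute_sym; apply: (class_2group_invol_central G4 sQG pQ).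
exists g; split=> //; last by move=> g21; rewrite g21 eqxx in g2.
split=> //; apply: join_gen => //; apply/subsetP=> r Qr.
case: (sgn r Qr) => [cr | rP]; first exact: centC.
by rewrite -(groupMr r (cycle_id g)); apply: centC; [apply: groupM | apply: inv_mul].
Qed.

End Class4.

(** * Passage between the structure and the generalized dicyclic groups *)

Section Classification.

Variables (gT : finGroupType) (G : {group gT}).

Lemma integral_graph_setmx S : connection_set G S ->
  integral_graph G (cayley_edge S) <-> int_spectrum (setmx G S).
Proof. by case=> sSG _ SV; rewrite /integral_graph (adjacency_setmx sSG SV). Qed.

Lemma Cayley_integral_in_class k : Cayley_integral G -> in_class k G.
Proof. by move=> iG S cS _; apply: iG. Qed.

Lemma dicyclic_Cayley_integral (P : {group gT}) x :
  dicyclic_over G P x -> #|P| = 3 -> Cayley_integral G.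
Proof.
move=> dG P3 S cS; apply/(integral_graph_setmx cS); case: cS => sSG _ SV.
by apply: (int_spectrum_dicyclic dG) => //; right.
Qed.

(** As [x^2] has order 2, five elements stay below the bound [3 * 2]. *)
Lemma dicyclic_in_class5 (P : {group gT}) x :
  dicyclic_over G P x -> x ^+ 2 != 1 -> in_class 5 G.
Proof.
move=> dG x2 S cS cardS; apply/(integral_graph_setmx cS); case: cS => sSG _ SV.
apply: (int_spectrum_dicyclic dG) => //; left.
by rewrite (nt_prime_order _ (dic_t2 dG)).
Qed.

(** With [C = <c>], the unique involution [x^2] of [A] is [c^3], and [P] is [E <c^2>]. For [n > 0],
    a nontrivial element of [E] is independent of [c^2]. *)
Lemma dic_E3n_Z6 n (A : {group gT}) : is_E3n_Z6 n A -> gen_dicyclic A G ->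
  exists (P : {group gT}) (x : gT), [/\ dicyclic_over G P x, x ^+ 2 != 1 &
    0 < n -> exists a b, [/\ a \in P, b \in P & indep3 b a]].
Proof.
case=> E [C [abE cardE cycC cardC defA]] [cAA A2 cardG [t [x [invA defG x2 xA]]]].
have [_ defAM cEC tiEC] := dprodP defA.
have [cEE E3] := abelemP (isT : prime 3) abE.
have [c defC] := cyclicP cycC.
have oc : #[c] = 6 by rewrite orderE -defC.
have Cc : c \in C by rewrite defC cycle_id.
have [sEA sCA] : E \subset A /\ C \subset A by rewrite -defAM mulG_subl mulG_subr.
have Ac := subsetP sCA c Cc.
have c6 : c ^+ 6 = 1 by rewrite -oc expg_order.
have At : t \in A /\ #[t] = 2.
  by have /setP/(_ t) := invA; rewrite !inE eqxx => /andP[-> /eqP].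
have Ec3 : c ^+ 3 = t.
  have /setP/(_ (c ^+ 3)) := invA; rewrite !inE groupX //.
  by rewrite orderXdiv oc //= => /esym/eqP.
pose b := c ^+ 2; have ob : #[b] = 3 by rewrite orderXdiv oc.
have Cb : b \in C by rewrite groupX.
have t1 : t != 1 by rewrite -order_eq1 At.2.
have t2 : t ^+ 2 = 1 by rewrite -Ec3 -expgM.
have b3 : b ^+ 3 = 1 by rewrite -ob expg_order.
have cEb : <[b]> \subset 'C(E) by rewrite cycle_subG (subsetP cEC).
pose P := (E <*> <[b]>)%G.
have defP : P :=: E * <[b]> by rewrite /= cent_joinEr.
have sPA : P \subset A by rewrite join_subG sEA cycle_subG (subsetP sCA).
have sAG : A \subset G by rewrite -defG joing_subl.
have Gx : x \in G by rewrite -defG mem_gen // inE cycle_id orbT.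
have [Pb sEP] : b \in P /\ E \subset P by rewrite mem_gen ?inE ?cycle_id ?orbT ?joing_subl.
exists P, x; split; last first.
- move=> n0; have ntE : E :!=: 1.
    by rewrite trivg_card1 cardE -(expn0 3) eqn_exp2l // -lt0n.
  have [a Ea a1] := trivgPn _ ntE; exists a, b; split=> //; first exact: (subsetP sEP).
  have b1 : b != 1 by rewrite -order_eq1 ob.
  have notC z : z \in C -> a != z.
    move=> Cz; apply: contraNneq a1 => Dz; rewrite -in_set1 -[[set 1]]/(1 : {set gT})
      -tiEC inE Ea.
    by rewrite Dz.
  split=> //; first exact: E3.
    exact: (centsP cAA _ (subsetP sPA _ Pb) _ (subsetP sEA _ Ea)).
  by split=> //; apply: notC; rewrite ?groupV.
- by rewrite x2.
split.
- exact: subset_trans sPA sAG.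
- split; first exact: abelianS cAA.
  move=> p; rewrite defP => /mulsgP[e y Ee /cycleP[i ->] ->].
  rewrite expgMn; last by apply: (centsP cAA);
    [apply: (subsetP sEA) | apply/groupX/(subsetP sCA)].
  by rewrite E3 // mul1g -expgM mulnC expgM b3 expg1n.
- by split=> //; rewrite (expgM x 2 2) x2.
- by move=> p /(subsetP sPA)/xA.
apply/eqP; rewrite eqEsubset join_subG (subset_trans sPA sAG) cycle_subG Gx /= -defG.
rewrite join_subG [in X in _ && X]joing_subr andbT -defAM mul_subG //.
  exact: subset_trans sEP (joing_subl _ _).
rewrite defC cycle_subG.
have -> : c = b^-1 * x ^+ 2 by rewrite x2 -Ec3 (expgSr c 2) mulKg.
rewrite groupM ?groupV //; first by rewrite (subsetP (joing_subl _ _)).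
by rewrite groupX // (subsetP (joing_subr _ _)) ?cycle_id.
Qed.

(** The elementary abelian group [P] splits as [E x <z>] with [z] of order 3, so
    [P x <t> = E x (<z> x <t>)], where the second factor is cyclic of order 6. [E] is nontrivial
    because [|P| <> 3]. *)
Lemma dicyclic_gen_dicyclic (P : {group gT}) x :
    dicyclic_over G P x -> x ^+ 2 != 1 -> P :!=: 1 -> #|P| != 3 ->
  exists (n : nat) (A : {group gT}), [/\ 1 <= n, is_E3n_Z6 n A & gen_dicyclic A G].
Proof.
move=> dG x2 ntP P3; have [sPG [cPP expP] [Gx x4] px defG] := dG.
have abP : 3.-abelem P by apply/abelemP.
pose t := x ^+ 2; have t2 := dic_t2 dG.
have ot : #[t] = 2 := nt_prime_order (isT : prime 2) t2 x2.
have cPt : <[t]> \subset 'C(P) := dic_centPZ dG.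
have p3 : 3.-group P := abelem_pgroup abP.
have tiP k (z : gT) : #[z] = (2 ^ k)%N -> P :&: <[z]> = 1.
  move=> oz; apply: coprime_TIg; rewrite -orderE oz.
  by apply: (pnat_coprime p3); rewrite pnatX.
have tiPt : P :&: <[t]> = 1 := tiP 1%N t ot.
have defA : P \x <[t]> = P <*> <[t]> by rewrite dprodEY.
have ox : #[x] = 4.
  have : #[x] %| 2 ^ 2 by rewrite order_dvdn x4.
  case/(dvdn_pfactor _ _ (isT : prime 2)) => -[|[|[|//]]] //= _ E; move: x2;
    by rewrite -order_dvdn E.
have [z Pz z1] := trivgPn _ ntP.
have oz : #[z] = 3 := nt_prime_order (isT : prime 3) (expP z Pz) z1.
have szP : <[z]> \subset P by rewrite cycle_subG.
have /splitsP[E /complP[tizE defzE]] := abelem_splits abP szP.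
have sEP : E \subset P by rewrite -defzE mulG_subr.
have defEz : E \x <[z]> = P.
  have czE : <[z]> \subset 'C(E) by apply: (subset_trans szP);
    apply: subset_trans cPP (centS sEP).
  by rewrite dprodE 1?setIC // -(centC czE).
have defzt : <[z]> \x <[t]> = <[z]> <*> <[t]>.
  rewrite dprodEY //; first exact: subset_trans cPt (centS szP).
  by apply/trivgP; rewrite -tiPt setSI.
have cardA : #|P <*> <[t]>| = (#|P| * 2)%N by rewrite -(dprod_card defA) -orderE ot.
have cardG : #|G| = (#|P| * 4)%N.
  rewrite -defG norm_joinEr; last first.
    by rewrite cycle_subG inE; apply/subsetP=> _ /imsetP[p Pp ->]; rewrite px ?groupV.
  by rewrite TI_cardMg ?(tiP 2%N) // -orderE ox.
have [sZG sAG sPA] := dic_sub dG.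
exists (logn 3 #|E|), (P <*> <[t]>)%G; split.
- rewrite lt0n; apply: contraNneq P3 => E0; rewrite -(dprod_card defEz).
  by rewrite (card_pgroup (pgroupS sEP p3)) E0 -orderE oz.
- exists E, (<[z]> <*> <[t]>)%G; split.
  + exact: abelemS abP.
  + exact: card_pgroup (pgroupS sEP p3).
  + by rewrite (cyclic_dprod defzt) ?cycle_cyclic // -!orderE oz ot.
  + by rewrite -(dprod_card defzt) -!orderE oz ot.
  by rewrite /= -defzt dprodA defEz defA.
split; first exact: dic_abelE dG.
- have leP : 3 <= #|P| by rewrite -oz dvdn_leq ?cardG_gt0 ?order_dvdG.
  by rewrite cardA; apply: leq_trans (leq_mul leP (leqnn 2)).
- by rewrite cardG cardA mulnCA.
exists t, x; split=> //.
- apply/setP=> a; rewrite !inE; apply/idP/eqP=> [/andP[Aa /eqP oa] | ->]; last first.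
    by rewrite ot eqxx andbT mem_gen // inE cycle_id orbT.
  have [p Pp [w Zw Da]] := dic_memE dG Aa.
  have cpw : commute p w by case: (dic_Z dG Zw) => ->;
    [apply: commute1 | apply: (dic_commPt dG)].
  have w2 : w ^+ 2 = 1 by case: (dic_Z dG Zw) => ->; rewrite ?expg1n.
  have p1 : p = 1.
    apply: expg23_1; last exact: expP.
    by rewrite -[LHS]mulg1 -[in LHS]w2 -expgMn // -Da -oa expg_order.
  move: Da oa; rewrite p1 mul1g => ->; case: (dic_Z dG Zw) => -> //.
  by rewrite order1.
- apply/eqP; rewrite eqEsubset join_subG sAG cycle_subG Gx /= -defG join_subG joing_subr
  andbT.
  by rewrite (subset_trans sPA) ?joing_subl.
by move=> a; apply: (dic_conjE dG).
Qed.

End Classification.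

(** * The classes for each bound on the size of connection sets *)

Theorem theorem1p3 :
  (forall k : nat, 6 <= k ->
     forall (gT : finGroupType) (G : {group gT}),
       in_class k G <-> Cayley_integral G)
  /\
  (forall (gT : finGroupType) (G : {group gT}),
     (in_class 4 G <-> in_class 5 G)
     /\
     (in_class 4 G <->
        Cayley_integral G
        \/ exists (n : nat) (A : {group gT}),
             [/\ 1 <= n, is_E3n_Z6 n A & gen_dicyclic A G])).
Proof.
have dic5 gT (G : {group gT}) n (A : {group gT}) :
    is_E3n_Z6 n A -> gen_dicyclic A G -> in_class 5 G.
  move=> eA dA; have [P [x [dG x2 _]]] := dic_E3n_Z6 eA dA.
  exact: dicyclic_in_class5 dG x2.
have class4 gT (G : {group gT}) : in_class 4 G -> Cayley_integral G \/
    exists (n : nat) (A : {group gT}), [/\ 1 <= n, is_E3n_Z6 n A & gen_dicyclic A G].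
  move=> G4; case: (class4_structure G4) => [cG | [P [x [dG ntP x2P]]]].
    left=> S cS; apply/(integral_graph_setmx cS); case: cS => sSG _ SV.
    apply: int_spectrum_setmx_conj => // [s | s g] Ss;
      first exact: class_order (subsetP sSG s Ss).
    by move=> Sg; apply: cG; apply: (subsetP sSG).
  (* [|P| = 3] gives the symmetric group of degree 3 or the dicyclic group of order 12, both Cayley
     integral. *)
  have [P3 | P3] := eqVneq #|P| 3; first by left; apply: dicyclic_Cayley_integral dG P3.
  right; apply: (dicyclic_gen_dicyclic dG) => //.
  by apply: contraNneq P3 => x2; rewrite x2P.
split=> [k k6 gT G | gT G]; split.
- move=> Gk; have G6 := in_class_leq k6 Gk.
  case: (class4 gT G (in_class_leq (isT : 4 <= 6) G6)) => // -[n [A [n0 eA dA]]].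
  (* Since [n >= 1], [P] contains two independent elements, and six elements outside [P <x^2>]
     exclude this alternative. *)
  have [P [x [dG x2 /(_ n0) [a [b [Pa Pb iba]]]]]] := dic_E3n_Z6 eA dA.
  have [sPG _ [Gx x4] px _] := dG.
  by case: (dic_not_in_class6 G6 (subsetP sPG a Pa) (subsetP sPG b Pb) Gx iba x4 x2 (px a
    Pa) (px b Pb)).
- exact: Cayley_integral_in_class.
- split; last exact: in_class_leq.
  case/class4=> [/Cayley_integral_in_class // | [n [A [n0 eA dA]]]].
  exact: dic5 eA dA.
split; first exact: class4.
case=> [/Cayley_integral_in_class // | [n [A [n0 eA dA]]]].
exact: in_class_leq (dic5 _ _ _ _ eA dA).
Qed.
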